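(* For every $2\le q\le p<\infty$, \[ \int_0^\infty\Bigl(\Bigl(\frac{\sin\pi t}{\pi t}\Bigr)^*\Bigr)^q t^{q/p-1}\,dt\le\int_0^\infty e^{-\pi q t^2/2}\,t^{q/p-1}\,dt . \] Equivalently, for all $q\ge2$ and $0<\alpha\le1$, \[ \int_0^\infty\Bigl(\Bigl(\frac{\sin t}{t}\Bigr)^*\Bigr)^q t^{\alpha-1}\,dt\le\frac12\,q^{-\alpha/2}(2\pi)^{\alpha/2}\,\Gamma(\alpha/2). \]
   Context: For a measurable function $h$ on $(0,\infty)$ (Lebesgue measure), $h^*$ denotes its nonincreasing rearrangement $h^*(s)=\inf\{\tau>0:\ |\{t>0:|h(t)|>\tau\}|\le s\}$; here $h(t)=\sin(\pi t)/(\pi t)$ (resp. $\sin t/t$) on $(0,\infty)$. $\Gamma$ is the Gamma function. *)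

(* Defs.v *)
From HB Require Import structures.
From mathcomp Require Import all_boot all_order all_algebra.
From mathcomp Require Import all_classical all_reals all_analysis.
Set Implicit Arguments. Unset Strict Implicit. Unset Printing Implicit Defensive.
Import Order.TTheory GRing.Theory Num.Theory.
Import numFieldNormedType.Exports.
Local Open Scope classical_set_scope.
Local Open Scope ring_scope.

Definition distrib {R : realType} (h : R -> R) (tau : R) : \bar R :=
  (@lebesgue_measure R) [set t : R | 0 < t /\ tau < `|h t|].

Definition rearr {R : realType} (h : R -> R) (s : R) : R :=
  inf [set tau : R | 0 < tau /\ (distrib h tau <= s%:E)%E].

Definition sincpi {R : realType} (t : R) : R := sin (pi * t) / (pi * t).
Definition sinc {R : realType} (t : R) : R := sin t / t.

Definition GammaE {R : realType} (x : R) : \bar R :=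
  (\int[@lebesgue_measure R]_(t in `]0%R, +oo[%classic) (t `^ (x - 1) * expR (- t))%:E)%E.

(* Main.v *)
Require Import Defs.
From HB Require Import structures.
From mathcomp Require Import all_boot all_order all_algebra.
From mathcomp Require Import all_classical all_reals all_analysis.
From mathcomp Require Import measurable_realfun zify ring lra.
Set Implicit Arguments. Unset Strict Implicit. Unset Printing Implicit Defensive.
Import Order.TTheory GRing.Theory Num.Theory.
Import numFieldNormedType.Exports.
Local Open Scope classical_set_scope.
Local Open Scope ring_scope.

(** Comparison of distribution functions (Nazarov and Podkorytov).
    Let G y be the measure of {t > 0 : |sin t / t| > y} and let
    F y = sqrt (2 pi ln (1 / y)) be the same quantity for the Gaussian
    exp (- t^2 / (2 pi)).  Once G exceeds F at some level it does so at every
    lower level.  Indeed, G <= F as long as only the main lobe of sinc counts,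
    since sin t <= t exp (- t^2 / 6) on [0, pi]; when z < y, z >= 0.19 and the
    second lobe reaches the level y, the two sides of that lobe, on which sinc
    is 0.34-Lipschitz, already make G z - G y >= F z - F y; and G >= F below
    0.19 by explicit lower bounds on the widths of the lobes.
    Hence the rearrangement g of sinc lies below the Gaussian f up to some t0
    and above it afterwards.  With K = (q / 2) y0^(q - 2) t0^(al - 1), y0 = f t0,
    this gives g^q t^(al - 1) + K f^2 <= f^q t^(al - 1) + K g^2 pointwise, and
    the theorem follows by integration from
    int g^2 <= int sinc^2 <= pi / 2 = int f^2.
    The bound on int sinc^2 comes from the Fejer kernel
    sin^2 (n x) / sin^2 x >= sin^2 (n x) / x^2, whose integral over [0, pi / 2]
    is n pi / 2. *)

(** * Numerical and trigonometric bounds *)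

Lemma ge0_derive_ge (R : realType) (f f' : R -> R) (a b : R) :
  (forall x, a <= x <= b -> is_derive x 1 f (f' x)) ->
  (forall x, a < x < b -> 0 <= f' x) ->
  a <= b -> f a <= f b.
Proof.
move=> df f'0; rewrite le_eqVlt => /predU1P[->//|ab].
have [||c cab fE] := @MVT R f f' a b ab.
- by move=> x; rewrite in_itv/= => /andP[ax xb]; apply: df; rewrite !ltW.
- apply: derivable_within_continuous => x; rewrite in_itv/= => xab.
  by have [] := df _ xab.
- rewrite -subr_ge0 fE mulr_ge0 ?subr_ge0 ?(ltW ab)//.
  by apply: f'0; move: cab; rewrite in_itv.
Qed.

Lemma derive_ge0 (R : realType) (f f' : R -> R) (b : R) :
  (forall x, 0 <= x <= b -> is_derive x 1 f (f' x)) ->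
  (forall x, 0 < x < b -> 0 <= f' x) ->
  f 0 = 0 -> 0 <= b -> 0 <= f b.
Proof. by move=> df f0 fz b0; rewrite -{1}fz; exact: (ge0_derive_ge df f0 b0). Qed.

Section trig.
Context {R : realType}.
Implicit Types x : R.

(** This starts a chain in which each difference has the previous one as its derivative and vanishes
    at 0. Five integrations of 1 - cos >= 0 and its successors give the Taylor bounds up to degree 5
    on the half-line x >= 0. *)
Lemma sin_le_id x : 0 <= x -> sin x <= x.
Proof.
move=> x0; rewrite -subr_ge0.
apply: (@derive_ge0 R (fun x => x - sin x) (fun x => 1 - cos x) x) => //.
by rewrite sin0 subrr.
Qed.

Lemma cos_ge_taylor2 x : 0 <= x -> 1 - x ^+ 2 / 2 <= cos x.
Proof.
move=> x0; rewrite -subr_ge0.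
apply: (@derive_ge0 R (fun x => cos x - (1 - x ^+ 2 / 2)) (fun x => x - sin x) x) => [y _|y /andP[y0 _]||//].
- by apply: is_derive_eq; rewrite /GRing.scale/=; lra.
- by rewrite subr_ge0 sin_le_id// ltW.
- by rewrite cos0; ring.
Qed.

Lemma sin_ge_taylor3 x : 0 <= x -> x - x ^+ 3 / 6 <= sin x.
Proof.
move=> x0; rewrite -subr_ge0.
apply: (@derive_ge0 R (fun x => sin x - (x - x ^+ 3 / 6)) (fun x => cos x - (1 - x ^+ 2 / 2)) x) => [y _|y /andP[y0 _]||//].
- by apply: is_derive_eq; rewrite /GRing.scale/=; lra.
- by rewrite subr_ge0 cos_ge_taylor2// ltW.
- by rewrite sin0; ring.
Qed.

Lemma cos_le_taylor4 x : 0 <= x -> cos x <= 1 - x ^+ 2 / 2 + x ^+ 4 / 24.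
Proof.
move=> x0; rewrite -subr_ge0.
apply: (@derive_ge0 R (fun x => (1 - x ^+ 2 / 2 + x ^+ 4 / 24) - cos x) (fun x => sin x - (x - x ^+ 3 / 6)) x) => [y _|y /andP[y0 _]||//].
- by apply: is_derive_eq; rewrite /GRing.scale/=; lra.
- by rewrite subr_ge0 sin_ge_taylor3// ltW.
- by rewrite cos0; ring.
Qed.

Lemma sin_le_taylor5 x : 0 <= x -> sin x <= x - x ^+ 3 / 6 + x ^+ 5 / 120.
Proof.
move=> x0; rewrite -subr_ge0.
apply: (@derive_ge0 R (fun x => (x - x ^+ 3 / 6 + x ^+ 5 / 120) - sin x) (fun x => (1 - x ^+ 2 / 2 + x ^+ 4 / 24) - cos x) x) => [y _|y /andP[y0 _]||//].
- by apply: is_derive_eq; rewrite /GRing.scale/=; lra.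
- by rewrite subr_ge0 cos_le_taylor4// ltW.
- by rewrite sin0; ring.
Qed.

(** The triple-angle formula at pi / 6 makes s = sin (pi / 6) a root of (s + 1) (2 s - 1)^2, and s >
    0 rules out -1. *)
Lemma sin_pi6 : sin (pi / 6) = 1 / 2 :> R.
Proof.
have p0 := pi_gt0 R.
have s0 : 0 < sin (pi / 6 : R) by apply: sin_gt0_pi; lra.
have : sin (pi / 2 : R) = 3 * sin (pi / 6) - 4 * sin (pi / 6) ^+ 3.
  rewrite (_ : pi / 2 = pi / 6 + (pi / 6 + pi / 6)); last by field.
  have c2 := cos2sin2 (pi / 6 : R).
  rewrite sinD sinD cosD.
  rewrite (_ : _ + _ = 3 * cos (pi / 6) ^+ 2 * sin (pi / 6) - sin (pi / 6) ^+ 3);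
    last by ring.
  rewrite c2; ring.
rewrite sin_pihalf => /eqP; rewrite eq_sym -subr_eq0.
rewrite (_ : _ - 1 = - ((sin (pi / 6) + 1) * (2 * sin (pi / 6) - 1) ^+ 2));
  last by ring.
rewrite oppr_eq0 mulf_eq0 sqrf_eq0 => /orP[|] /eqP; lra.
Qed.

(** The Taylor bound puts sin 0.5234 below 1/2 = sin (pi / 6), and sin is increasing there; the
    crude bound pi >= 2 keeps both points within [- pi / 2, pi / 2]. The upper bound on pi is
    obtained in the same way. *)
Lemma pi_gt314 : 314 / 100 < pi :> R.
Proof.
have p2 := pi_ge2 R.
have h : 5234 / 10000 < pi / 6 :> R.
  rewrite -ltr_sin; last 2 first.
  - by rewrite in_itv/=; apply/andP; split; lra.
  - by rewrite in_itv/=; apply/andP; split; lra.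
  rewrite sin_pi6; apply: (le_lt_trans (sin_le_taylor5 _)); lra.
lra.
Qed.

Lemma pi_lt315 : pi < 315 / 100 :> R.
Proof.
have p2 := pi_ge2 R.
have h : pi / 6 < 525 / 1000 :> R.
  rewrite -ltr_sin; last 2 first.
  - by rewrite in_itv/=; apply/andP; split; lra.
  - by rewrite in_itv/=; apply/andP; split; lra.
  rewrite sin_pi6; apply: (lt_le_trans _ (sin_ge_taylor3 _)); lra.
lra.
Qed.


Lemma sqr_lower_bound (a b c : R) : 0 <= a -> a <= b -> c <= a ^+ 2 -> c <= b ^+ 2.
Proof. by move=> a0 ab /le_trans; apply; rewrite lerXn2r// nnegrE// (le_trans a0). Qed.

(** e is the 128th power of exp (1 / 128) >= 129 / 128, reached by seven squarings with rounding
    down along the way. *)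
Lemma expR1_ge : 268 / 100 <= expR 1 :> R.
Proof.
have h : 129 / 128 <= expR (1 / 128) :> R.
  by apply: le_trans (expR_ge1Dx _); lra.
have -> : expR 1 = ((((((expR (1 / 128) ^+ 2) ^+ 2) ^+ 2) ^+ 2) ^+ 2) ^+ 2) ^+ 2 :> R.
  by rewrite -!exprM -expRM_natl; congr expR; field.
move: (expR _) h => e h.
have {}h : 10156 / 10000 <= e ^+ 2 by apply: sqr_lower_bound h _; lra.
have {}h : 10314 / 10000 <= (e ^+ 2) ^+ 2 by apply: sqr_lower_bound h _; lra.
have {}h : 10637 / 10000 <= ((e ^+ 2) ^+ 2) ^+ 2 by apply: sqr_lower_bound h _; lra.
move: (((e ^+ 2) ^+ 2) ^+ 2) h => {}e h.
have {}h : 11314 / 10000 <= e ^+ 2 by apply: sqr_lower_bound h _; lra.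
have {}h : 128 / 100 <= (e ^+ 2) ^+ 2 by apply: sqr_lower_bound h _; lra.
have {}h : 16384 / 10000 <= ((e ^+ 2) ^+ 2) ^+ 2 by apply: sqr_lower_bound h _; lra.
by apply: sqr_lower_bound h _; lra.
Qed.

(** An upper bound on exp comes from a lower bound at a negative point: exp (- 27 / 640) >= 1 - 27 /
    640, raised to the power 32 and inverted. *)
Lemma expR_le4 : expR (135 / 100) <= 4 :> R.
Proof.
have h : 9578 / 10000 <= expR (- (27 / 640)) :> R.
  by apply: le_trans (expR_ge1Dx _); lra.
have -> : expR (135 / 100) =
    (((((expR (- (27 / 640)) ^+ 2) ^+ 2) ^+ 2) ^+ 2) ^+ 2)^-1 :> R.
  by rewrite -!exprM -expRM_natl -expRN; congr expR; field.
move: (expR _) h => e h.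
have {}h : 9173 / 10000 <= e ^+ 2 by apply: sqr_lower_bound h _; lra.
have {}h : 8414 / 10000 <= (e ^+ 2) ^+ 2 by apply: sqr_lower_bound h _; lra.
have {}h : 7079 / 10000 <= ((e ^+ 2) ^+ 2) ^+ 2 by apply: sqr_lower_bound h _; lra.
move: (((e ^+ 2) ^+ 2) ^+ 2) h => {}e h.
have {}h : 501 / 1000 <= e ^+ 2 by apply: sqr_lower_bound h _; lra.
have {}h : 1 / 4 <= (e ^+ 2) ^+ 2 by apply: sqr_lower_bound h _; lra.
by rewrite invf_ple ?posrE; lra.
Qed.

(* With u = e^(t^2/6), the chain is (sin t - t cos t)' = t sin t >= 0,
   (sin t - t cos t - t^2 sin t / 3)' = t/3 (sin t - t cos t) >= 0 and
   (t - u sin t)' = 1 - u (cos t + t sin t / 3), whose own derivative is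
   2/3 u (sin t - t cos t - t^2 sin t / 6) >= 0. *)
Lemma sin_le_gauss x : 0 <= x <= pi -> sin x <= x * expR (- (x ^+ 2 / 6)).
Proof.
have sin0pi (y z : R) : 0 < y < z -> z <= pi -> 0 <= sin y.
  by case/andP => y0 yz zp; rewrite sin_ge0_pi// ltW//= ltW// (lt_le_trans yz).
have k1 (y : R) : 0 <= y <= pi -> 0 <= sin y - y * cos y.
  case/andP => y0 yp.
  apply: (@derive_ge0 _ (fun y => sin y - y * cos y) (fun y => y * sin y)) => //.
  - by move=> z _; apply: is_derive_eq; rewrite /GRing.scale/=; ring.
  - move=> z zy; have sz := sin0pi _ _ zy yp; case/andP: zy => z0 _.
    by rewrite mulr_ge0// ltW.
  - by rewrite sin0; ring.
have k2 (y : R) : 0 <= y <= pi -> 0 <= sin y - y * cos y - y ^+ 2 * sin y / 3.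
  case/andP => y0 yp.
  apply: (@derive_ge0 _ (fun y => sin y - y * cos y - y ^+ 2 * sin y / 3)
    (fun y => y / 3 * (sin y - y * cos y))) => //.
  - by move=> z _; apply: is_derive_eq; rewrite /GRing.scale/=; field.
  - move=> z /andP[z0 zy]; rewrite mulr_ge0 ?k1//.
      by rewrite divr_ge0 // ltW.
    by rewrite (ltW z0)/= ltW// (lt_le_trans zy).
  - by rewrite sin0; ring.
have k3 (y : R) : 0 <= y <= pi ->
    0 <= 1 - expR (y ^+ 2 / 6) * (cos y + y * sin y / 3).
  case/andP => y0 yp.
  apply: (@derive_ge0 _ (fun y => 1 - expR (y ^+ 2 / 6) * (cos y + y * sin y / 3))
    (fun y => 2 / 3 * expR (y ^+ 2 / 6) *
       (sin y - y * cos y - y ^+ 2 * sin y / 6))) => //.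
  - by move=> z _; apply: is_derive_eq; rewrite /GRing.scale/=; field.
  - move=> z zy; have sz := sin0pi _ _ zy yp; case/andP: zy => z0 zy.
    rewrite mulr_ge0 ?mulr_ge0 ?expR_ge0 ?divr_ge0//.
    have := k2 z; rewrite (ltW z0) (ltW (lt_le_trans zy yp)) => /(_ isT).
    have : 0 <= z ^+ 2 * sin z by rewrite mulr_ge0// sqr_ge0.
    lra.
  - by rewrite sin0 cos0 expr0n/= mul0r expR0; ring.
case/andP => x0 xp.
have : 0 <= x - expR (x ^+ 2 / 6) * sin x.
  apply: (@derive_ge0 _ (fun y => y - expR (y ^+ 2 / 6) * sin y)
    (fun y => 1 - expR (y ^+ 2 / 6) * (cos y + y * sin y / 3))) => //.
  - by move=> z _; apply: is_derive_eq; rewrite /GRing.scale/=; field.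
  - move=> z /andP[z0 zx]; apply: k3.
    by rewrite (ltW z0) (ltW (lt_le_trans zx xp)).
  - by rewrite sin0; ring.
by rewrite subr_ge0 expRN ler_pdivlMr ?expR_gt0// mulrC.
Qed.

End trig.

(** * Superlevel sets of sinc *)

Section superlevel.
Context {R : realType}.
Local Notation mu := (@lebesgue_measure R).
Implicit Types (h : R -> R) (t x y z : R).

Definition superlevel h y : set R := [set t | 0 < t /\ y < `|h t|].

Lemma superlevel_sub h y z : y <= z -> superlevel h z `<=` superlevel h y.
Proof. by move=> yz t [t0 zt]; split => //; exact: le_lt_trans zt. Qed.

Lemma measurable_superlevel h y :
  measurable_fun (`]0%R, +oo[%classic : set R) h -> measurable (superlevel h y).
Proof.
move=> mh.
rewrite (_ : superlevel h y =
   `]0%R, +oo[ `&` (Num.norm \o h) @^-1` `]y, +oo[); last first.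
  apply/seteqP; split => t /=; rewrite !in_itv/= !andbT.
  - by case=> t0 yt; rewrite t0.
  - by case.
have mnh : measurable_fun (`]0%R, +oo[%classic : set R) (Num.norm \o h).
  by apply: measurableT_comp => //; exact: normr_measurable.
exact: mnh.
Qed.

Lemma le_distrib h y z : measurable_fun (`]0%R, +oo[%classic : set R) h ->
  y <= z -> (distrib h z <= distrib h y)%E.
Proof.
move=> mh yz; apply: le_measure; rewrite ?inE.
- exact: measurable_superlevel.
- exact: measurable_superlevel.
- exact: superlevel_sub.
Qed.

Lemma lebesgue_measure_oo x y : x <= y -> mu `]x, y[ = (y - x)%:E.
Proof.
rewrite le_eqVlt lebesgue_measure_itv/= lte_fin => /predU1P[->|->].
  by rewrite ltxx subrr.
by rewrite EFinB.
Qed.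

Lemma lebesgue_measure_addoo (A B : set R) x y :
  measurable A -> measurable B -> B `<=` A -> `]x, y[ `<=` A ->
  (forall t, B t -> x < t -> t < y -> False) -> x <= y ->
  (mu B + (y - x)%:E <= mu A)%E.
Proof.
move=> mA mB BA xyA disj xy.
rewrite -(lebesgue_measure_oo xy) -measureU//; last first.
  apply/seteqP; split => // t [Bt]; rewrite /= in_itv/= => /andP[xt ty].
  exact: disj Bt xt ty.
apply: le_measure; rewrite ?inE//; first exact: measurableU.
by rewrite subUset.
Qed.

Lemma continuous_sinc t : t != 0 -> {for t, continuous (@sinc R)}.
Proof.
move=> t0; rewrite /sinc; apply: continuousM; first exact: continuous_sin.
exact: continuousV.
Qed.

Lemma measurable_sinc : measurable_fun (`]0%R, +oo[%classic : set R) (@sinc R).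
Proof.
apply: open_continuous_measurable_fun; first exact: interval_open.
move=> t; rewrite inE/= in_itv/= andbT => t0.
by apply: continuous_sinc; rewrite gt_eqF.
Qed.

Lemma measurable_superlevel_sinc y : measurable (superlevel (@sinc R) y).
Proof. by apply: measurable_superlevel; exact: measurable_sinc. Qed.
#[local] Hint Resolve measurable_superlevel_sinc : core.

Lemma superlevel_sincP y t :
  superlevel sinc y t <-> 0 < t /\ y * t < `|sin t|.
Proof.
rewrite /superlevel/=; split => -[t0]; rewrite /sinc normrM normfV (gtr0_norm t0).
- by rewrite ltr_pdivlMr.
- by rewrite -ltr_pdivlMr.
Qed.

Lemma superlevel_sinc_lt y t : 0 < y -> superlevel sinc y t -> t < y^-1.
Proof.
move=> y0 /superlevel_sincP[t0 yt].
rewrite -[y^-1]mul1r ltr_pdivlMr// mulrC.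
exact: lt_le_trans yt (sin_max _).
Qed.

Lemma is_derive_sinc t : t != 0 ->
  is_derive t 1 (@sinc R) ((t * cos t - sin t) / t ^+ 2).
Proof.
move=> t0; rewrite /sinc.
apply: (is_derive_eq (is_deriveM (is_derive_sin t) (is_deriveV t0 (is_derive_id t 1)))).
by rewrite /GRing.scale/=; field.
Qed.

(* On [[pi, +oo[] one has [|sinc' t| <= sqrt (1 + t^2) / t^2 <= 0.34]. *)
Lemma sinc_lipschitz t u : pi <= t -> t <= u ->
  `|sinc u - sinc t| <= 34 / 100 * (u - t).
Proof.
move=> pt tu.
have p0 := pi_gt314 (R := R).
have [||c + ->] := @MVT_segment R sinc (fun t => (t * cos t - sin t) / t ^+ 2) t u tu.
- move=> x; rewrite in_itv/= => /andP[tx xu]; apply: is_derive_sinc.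
  by rewrite gt_eqF//; lra.
- apply: continuous_in_subspaceT => x; rewrite inE/= in_itv/= => /andP[tx xu].
  by apply: continuous_sinc; rewrite gt_eqF//; lra.
rewrite in_itv/= => /andP[tc cu].
have c3 : 314 / 100 <= c by lra.
have ut : 0 <= u - t by rewrite subr_ge0.
rewrite normrM (ger0_norm ut) ler_wpM2r//.
have c0 : 0 < c by lra.
rewrite normrM normfV (ger0_norm (sqr_ge0 c)) ler_pdivrMr ?exprn_gt0//.
rewrite -ler_sqr ?nnegrE ?mulr_ge0 ?divr_ge0 ?sqr_ge0 ?(ltW c0)//.
rewrite real_normK ?num_real//.
have cs := cos2Dsin2 c.
have : (c * cos c - sin c) ^+ 2 <= c ^+ 2 + 1.
  have -> : c ^+ 2 + 1 = (c * cos c - sin c) ^+ 2 + (c * sin c + cos c) ^+ 2.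
    transitivity ((c ^+ 2 + 1) * (cos c ^+ 2 + sin c ^+ 2)); last by ring.
    by rewrite cs mulr1.
  by rewrite lerDl sqr_ge0.
move=> /le_trans; apply.
have c2 : 98 / 10 <= c ^+ 2.
  have : (c - 314 / 100) * (c + 314 / 100) >= 0 by apply: mulr_ge0; lra.
  lra.
move: (c ^+ 2) c2 => d d9.
have : (d - 98 / 10) * (d - 1) >= 0 by apply: mulr_ge0; lra.
nra.
Qed.

(** From pi on, |sin t| <= t / 4: beyond 4 because |sin t| <= 1, and on [pi, 4] because |sin t| =
    sin (t - pi) <= t - pi <= t / 4. So only the main lobe reaches the level 1/4. *)
Lemma superlevel_sinc_pi y t : 1 / 4 <= y -> superlevel sinc y t -> t < pi.
Proof.
move=> y4 /superlevel_sincP[t0 yt]; rewrite ltNge; apply/negP => pt.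
have p0 := pi_gt314 (R := R); have p1 := pi_lt315 (R := R).
have {y4 yt}h : t / 4 < `|sin t|.
  by apply: le_lt_trans yt; rewrite mulrC ler_pM2r//; lra.
have [t4|t4] := leP 4 t.
  by have := sin_max t; lra.
have h1 : sin t = - sin (t - pi) by rewrite -{1}(subrK pi t) sinDpi.
have h2 : 0 <= sin (t - pi) by apply: sin_ge0_pi; lra.
have h3 : sin (t - pi) <= t - pi by apply: sin_le_id; lra.
by move: h; rewrite h1 normrN ger0_norm//; lra.
Qed.

(* The two rims of width [delta] around the part of the superlevel set lying
   beyond [pi] belong to the lower superlevel set because [sinc] is
   Lipschitz there and vanishes at [pi]. *)
Lemma distrib_sinc_growth y z t : 0 < z -> z < y ->
  pi <= t -> superlevel sinc y t ->
  (distrib sinc y + (2 * ((y - z) / (34 / 100)))%:E <= distrib sinc z)%E.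
Proof.
move=> z0 zy pt At.
have p0 := pi_gt0 R.
pose d := (y - z) / (34 / 100).
have d0 : 0 < d by rewrite divr_gt0 ?subr_gt0//; lra.
have dE : 34 / 100 * d = y - z by rewrite /d; field.
pose U := [set u | pi <= u /\ superlevel sinc y u].
have Ut : U t by [].
have y0 : 0 < y by exact: lt_trans zy.
have supU : has_sup U.
  split; first by exists t.
  by exists y^-1 => u [_ /(superlevel_sinc_lt y0)/ltW].
have infU : has_inf U.
  by split; [exists t | exists pi => u []].
have close u v : U u -> pi <= v -> `|u - v| < d -> superlevel sinc z v.
  move=> [pu [u0 yu]] pv uv; split; first exact: lt_le_trans pv.
  have : `|sinc u - sinc v| <= 34 / 100 * `|u - v|.
    have [|/ltW] := leP v u => uv'.
    - by rewrite (ger0_norm (_ : 0 <= u - v)) ?subr_ge0//; exact: sinc_lipschitz.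
    - by rewrite distrC (distrC u) (ger0_norm (_ : 0 <= v - u)) ?subr_ge0//;
        exact: sinc_lipschitz.
  have := ler_normD (sinc v) (sinc u - sinc v); rewrite (addrC (sinc v)) subrK.
  have : 34 / 100 * `|u - v| < 34 / 100 * d by rewrite ltr_pM2l//; lra.
  by rewrite dE; lra.
have sinc_pi : sinc pi = 0 :> R by rewrite /sinc sinpi mul0r.
set m := inf U; set M := sup U.
have mU u : U u -> m <= u by move=> Uu; apply: ge_inf => //; exact: infU.2.
have UM u : U u -> u <= M by move=> Uu; apply: ub_le_sup => //; exact: supU.2.
have pm : pi <= m by apply: lb_le_inf; [exists t | move=> u []].
(* The rim cannot extend below [pi]: otherwise [pi] itself would be within [d] of a point of [U],
   hence in the lower superlevel set, although [sinc pi] is 0. *)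
have left_rim v : `]m - d, m[%classic v -> pi <= v /\ superlevel sinc z v.
  rewrite /= in_itv/= => /andP[mv vm].
  have [|u Uu um] := inf_adherent (_ : 0 < v - (m - d)) infU.
    by rewrite subr_gt0.
  have uv : `|u - v| < d.
    have mu' := mU _ Uu; rewrite -/m in um.
    by rewrite ger0_norm; lra.
  have [pv|vp] := leP pi v; first by split=> //; exact: close uv.
  have [_] : superlevel sinc z pi.
    apply: (close u) => //; have mu' := mU _ Uu; rewrite -/m in um.
    by rewrite ger0_norm; lra.
  by rewrite sinc_pi normr0 ltNge (ltW z0).
have right_rim : `]M, M + d[ `<=` superlevel sinc z.
  move=> v /=; rewrite in_itv/= => /andP[Mv vM].
  have [|u Uu Mu] := sup_adherent (_ : 0 < M + d - v) supU.
    by rewrite subr_gt0.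
  have uM := UM _ Uu; rewrite -/M in Mu.
  apply: (close u) => //.
  - by have [] := Uu; lra.
  - by rewrite ler0_norm; lra.
(* The two rims are added one after the other. The left one misses the upper superlevel set because
   it lies beyond [pi] but below the infimum of [U]. *)
pose B := superlevel sinc y `|` `]m - d, m[.
have mB : measurable B by apply: measurableU.
have Az := superlevel_sub (ltW zy) (h := sinc).
have Bz : B `<=` superlevel sinc z.
  by rewrite /B subUset; split=> // v /left_rim[].
have h1 : (mu (superlevel sinc y) + (m - (m - d))%:E <= mu B)%E.
  apply: lebesgue_measure_addoo => //.
  - by move=> v; left.
  - by move=> v; right.
  - move=> v Av mv vm.
    have [pv _] : pi <= v /\ superlevel sinc z v.
      by apply: left_rim; rewrite /= in_itv/= mv.
    by have := mU v (conj pv Av); rewrite leNgt vm.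
  - by lra.
have h2 : (mu B + (M + d - M)%:E <= mu (superlevel sinc z))%E.
  apply: lebesgue_measure_addoo => //.
  - move=> v [Av|]; last first.
      by rewrite /= in_itv/= => /andP[_ vm] Mv _; have := mU _ Ut; have := UM _ Ut; lra.
    move=> Mv vM; have := UM v (conj _ Av).
    by have := mU _ Ut; have := UM _ Ut; lra.
  - by lra.
rewrite /distrib -/(superlevel _ _) -/(superlevel _ _).
apply: le_trans h2; rewrite (_ : 2 * _ = (m - (m - d)) + (M + d - M)); last by rewrite /d; ring.
by rewrite EFinD addeA leeD2r.
Qed.
End superlevel.

(** * Crossing of the distribution functions *)

Section crossing.
Context {R : realType}.
Local Notation mu := (@lebesgue_measure R).
Local Notation pi := (@pi R).
Implicit Types (t u x y z : R).

(** The inverse function of the Gaussian exp (- t^2 / (2 pi)) on ]0, 1]. For y >= 1 it is 0, since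
    [Num.sqrt] sends nonpositive reals to 0, in agreement with an empty superlevel set. *)
Definition gauss_width y : R := Num.sqrt (2 * pi * ln y^-1).

(** Here [L] is an explicit upper estimate of ln (1 / y), so that the logarithm is replaced by a
    bound on an exponential. *)
Lemma gauss_width_le y v L : 0 < y -> 0 <= v -> 1 <= y * expR L ->
  2 * pi * L <= v ^+ 2 -> gauss_width y <= v.
Proof.
move=> y0 v0 yL Lv; have p0 := pi_gt0 R.
rewrite -(ger0_norm v0) -sqrtr_sqr ler_wsqrtr//.
apply: le_trans Lv; rewrite ler_pM2l; last by lra.
rewrite -(expRK L) ler_ln ?posrE ?invr_gt0 ?expR_gt0//.
by rewrite -[y^-1]mul1r ler_pdivrMr// mulrC.
Qed.

Lemma gauss_width_lt y z : 0 < y -> y < z -> y < 1 -> gauss_width z < gauss_width y.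
Proof.
move=> y0 yz y1; have p0 := pi_gt0 R.
have z0 : 0 < z by exact: lt_trans yz.
have h : 0 < 2 * pi * ln y^-1.
  by rewrite mulr_gt0 ?ln_gt0 ?invf_gt1//; lra.
by rewrite ltr_sqrt// ltr_pM2l ?ltr_ln ?posrE ?invr_gt0 ?ltf_pV2 ?posrE//; lra.
Qed.

Lemma gauss_width_expR t : 0 <= t -> gauss_width (expR (- (t ^+ 2 / (2 * pi)))) = t.
Proof.
move=> t0; rewrite /gauss_width -expRN opprK expRK mulrC divfK ?sqrtr_sqr ?ger0_norm//.
by rewrite mulf_neq0// gt_eqF// pi_gt0.
Qed.

(** On the main lobe y < sin t / t <= exp (- t^2 / 6), hence t^2 < 6 ln (1 / y) <= 2 pi ln (1 / y),
    the last step because pi > 3. The superlevel set is thus inside an interval of length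
    [gauss_width y]. *)
Lemma distrib_sinc_le_width y : 0 < y ->
  (forall t, superlevel sinc y t -> t < pi) ->
  (distrib sinc y <= (gauss_width y)%:E)%E.
Proof.
move=> y0 Api; have p0 := pi_gt314 (R := R).
rewrite -[gauss_width y]subr0 -lebesgue_measure_oo ?sqrtr_ge0//.
apply: le_measure; rewrite ?inE//; first exact: measurable_superlevel_sinc.
move=> t At; have tp := Api t At; have /superlevel_sincP[t0 yt] := At.
rewrite /= in_itv/= t0/=.
have st : 0 <= sin t by apply: sin_ge0_pi; rewrite (ltW t0) ltW.
have yl : y < expR (- (t ^+ 2 / 6)).
  rewrite -(ltr_pM2r t0) (lt_le_trans yt)// ger0_norm// mulrC.
  by apply: sin_le_gauss; rewrite (ltW t0) ltW.
have ly : t ^+ 2 / 6 < ln y^-1.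
  rewrite lnV ?posrE// ltrNr -(expRK (- _)) ltr_ln ?posrE ?expR_gt0//.
rewrite -[t]ger0_norm ?(ltW t0)// -sqrtr_sqr ltr_sqrt.
  have : 0 <= t ^+ 2 by exact: sqr_ge0.
  nra.
by rewrite mulr_gt0//; [lra|apply: le_lt_trans ly; rewrite divr_ge0 ?sqr_ge0].
Qed.

(** With d = y - z, the inequality ln (1 + x) <= x bounds the growth of the squared width by 2 pi d
    / z, while squaring the right side adds at least 2 (2 d / 0.34) [gauss_width y]. For y <= 1/4
    the width is at least 2.9. *)
Lemma gauss_width_lipschitz y z : 19 / 100 <= z -> z < y -> y <= 1 / 4 ->
  gauss_width z <= gauss_width y + 2 * ((y - z) / (34 / 100)).
Proof.
move=> z19 zy y4; have p0 := pi_gt314 (R := R); have p1 := pi_lt315 (R := R).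
have y0 : 0 < y by lra.
have z0 : 0 < z by lra.
have lny : 135 / 100 <= ln y^-1.
  rewrite -(expRK (135 / 100)) ler_ln ?posrE ?invr_gt0 ?expR_gt0//.
  by apply: (le_trans expR_le4); rewrite -[y^-1]mul1r ler_pdivlMr//; lra.
have lnz : ln z^-1 <= ln y^-1 + (y - z) / z.
  rewrite [in leLHS](_ : z^-1 = y^-1 * (1 + (y - z) / z)); last first.
    by field; rewrite !gt_eqF.
  have yz : 0 <= (y - z) / z by rewrite divr_ge0; lra.
  rewrite lnM ?posrE ?invr_gt0//; last by lra.
  by rewrite lerD2l; apply: le_ln1Dx; lra.
have Wy2 : gauss_width y ^+ 2 = 2 * pi * ln y^-1.
  by rewrite sqr_sqrtr// mulr_ge0; lra.
have Wz0 : 0 <= gauss_width z by exact: sqrtr_ge0.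
have Wy0 : 0 <= gauss_width y by exact: sqrtr_ge0.
have Wy : 29 / 10 <= gauss_width y.
  rewrite -ler_sqr ?nnegrE//.
  rewrite Wy2; move: (ln y^-1) lny => l lny.
  have : 0 <= (pi - 314 / 100) * (l - 135 / 100) by apply: mulr_ge0; lra.
  lra.
rewrite /gauss_width -[leRHS]ger0_norm; last first.
  by rewrite addr_ge0// mulr_ge0// divr_ge0; lra.
rewrite -sqrtr_sqr ler_wsqrtr//.
apply: (@le_trans _ _ (2 * pi * (ln y^-1 + (y - z) / z))).
  by rewrite ler_pM2l//; lra.
rewrite -/(gauss_width y) mulrDr -Wy2 sqrrD -addrA lerD2l.
have d0 : 0 < y - z by lra.
move: (y - z) d0 => d d0.
(* The number 34 separates 2 pi / 0.19 < 33.2 from 4 * 2.9 / 0.34 > 34.1. *)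
apply: (@le_trans _ _ (34 * d)).
  rewrite mulrCA mulrA ler_pdivrMr//; nra.
have : 0 <= (2 * (d / (34 / 100))) ^+ 2 by exact: sqr_ge0.
rewrite (_ : d / (34 / 100) = 100 / 34 * d); last by field.
nra.
Qed.

(** Strict concavity of sin on [0, pi]: if sin were not above the line at [u], the mean value
    theorem on each side would give c < c' with cos c <= y <= cos c', against the strict decrease of
    cos. *)
Lemma sin_gt_line (y s a b u : R) : 0 <= a -> a < u -> u < b -> b <= pi ->
  y * a + s <= sin a -> y * b + s <= sin b -> y * u + s < sin u.
Proof.
move=> a0 au ub bp ha hb; rewrite ltNge; apply/negP => hu.
have df x : is_derive x 1 (fun x => sin x - (y * x + s)) (cos x - y).
  by apply: is_derive_eq; rewrite /GRing.scale/=; ring.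
have cf v w : {within `[v, w], continuous (fun x : R => sin x - (y * x + s))}.
  by apply: derivable_within_continuous => x _; have [] := df x.
have [c cab hc] := @MVT R _ _ a u au (fun x _ => df x) (cf a u).
have [c' cab' hc'] := @MVT R _ _ u b ub (fun x _ => df x) (cf u b).
move: cab cab'; rewrite !in_itv/= => /andP[ac cu] /andP[uc cb].
have : cos c' < cos c.
  by rewrite ltr_cos ?in_itv/= ?(lt_trans cu)//; apply/andP; split; lra.
have : (cos c - y) * (u - a) <= 0 by rewrite -hc; lra.
have : 0 <= (cos c' - y) * (b - u) by rewrite -hc'; lra.
rewrite pmulr_lge0 ?subr_gt0// pmulr_lle0 ?subr_gt0//; lra.
Qed.

Lemma norm_sin_natpi n u : `|sin (n%:R * pi + u)| = `|sin u|.
Proof.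
by rewrite addrC mulr_natl (alternatingn (@sinDpi R)) normrM normrX normrN1 expr1n mul1r.
Qed.

(** [c], [c1] and [c2] are the margins cut off the first two lobes, leaving ]0, pi - c[ and ]pi +
    c1, 2 pi - c2[. By concavity it is enough to test the endpoints; the second lobe is shifted back
    by [pi], which turns y t into a line with intercept y pi. *)
Lemma distrib_sinc_two_lobes y c c1 c2 : 0 < y -> 0 < c -> c < pi ->
  0 <= c1 -> c1 < pi - c2 -> 0 <= c2 ->
  y * (pi - c) <= sin c -> y * (pi + c1) <= sin c1 ->
  y * (2 * pi - c2) <= sin c2 ->
  ((2 * pi - c - c1 - c2)%:E <= distrib sinc y)%E.
Proof.
move=> y0 c0 cp c10 c12 c20 hc hc1 hc2; have p0 := pi_gt0 R.
rewrite (_ : _ - c2 = (pi - c - 0) + (2 * pi - c2 - (pi + c1))); last by ring.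
rewrite EFinD -lebesgue_measure_oo; last by lra.
have sinpiB x : sin (pi - x) = sin x by rewrite addrC sinDpi sinN opprK.
apply: lebesgue_measure_addoo => //.
- exact: measurable_superlevel_sinc.
- move=> t; rewrite /= in_itv/= => /andP[t0 tc]; apply/superlevel_sincP; split=> //.
  apply: lt_le_trans (ler_norm _); rewrite -[y * t]addr0.
  by apply: (@sin_gt_line _ _ 0 (pi - c)) => //; rewrite ?sin0 ?sinpiB; lra.
- move=> t; rewrite /= in_itv/= => /andP[ct tc]; apply/superlevel_sincP.
  split; first by lra.
  have -> : t = 1%:R * pi + (t - pi) by ring.
  rewrite norm_sin_natpi; apply: lt_le_trans (ler_norm _).
  rewrite mul1r mulrDr addrC.
  by apply: (@sin_gt_line _ _ c1 (pi - c2)) => //; rewrite ?sinpiB; lra.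
- by move=> t; rewrite /= in_itv/= => /andP[t0 tc]; lra.
- by lra.
Qed.

(** On the middle two thirds of each of the first N lobes |sin t| > 1/2, while y t < y N pi <= 1/2;
    each lobe therefore contributes 2 pi / 3. Truncating at n pi in [B] makes the next interval
    disjoint from what was counted. *)
Lemma distrib_sinc_many_lobes y N : 0 < y -> y * (N%:R * pi) <= 1 / 2 ->
  ((N%:R * (2 * pi / 3))%:E <= distrib sinc y)%E.
Proof.
move=> y0 yN; have p0 := pi_gt0 R.
pose B n := superlevel sinc y `&` `]0, n%:R * pi[.
have mB n : measurable (B n).
  by apply: measurableI; [exact: measurable_superlevel_sinc|exact: measurable_itv].
suff H n : (n <= N)%N -> ((n%:R * (2 * pi / 3))%:E <= mu (B n))%E.
  apply: (le_trans (H N (leqnn N))).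
  apply: le_measure; rewrite ?inE.
  - exact: mB.
  - exact: measurable_superlevel_sinc.
  - by move=> t [].
elim: n => [_|n IH nN]; first by rewrite mul0r.
rewrite (_ : n.+1%:R * _ =
  n%:R * (2 * pi / 3) + (n%:R * pi + 5 * pi / 6 - (n%:R * pi + pi / 6))); last first.
  by rewrite -natr1; field.
rewrite EFinD; apply: (@le_trans _ _ (mu (B n) + (n%:R * pi + 5 * pi / 6 - (n%:R * pi + pi / 6))%:E)%E).
  by rewrite leeD2r// IH// ltnW.
have n0 : 0 <= n%:R * pi by rewrite mulr_ge0//; lra.
apply: lebesgue_measure_addoo => //.
- move=> t [At]; rewrite /= in_itv/= => /andP[t0 tn]; split=> //=.
  by rewrite in_itv/= t0/= -natr1; lra.
- move=> t; rewrite /= in_itv/= => /andP[nt tn].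
  have tN : t < N%:R * pi.
    have : n.+1%:R * pi <= N%:R * pi by rewrite ler_pM2r// ler_nat.
    by rewrite -natr1; lra.
  split; last by rewrite /= in_itv/= -natr1; apply/andP; split; lra.
  apply/superlevel_sincP; split; first by lra.
  have -> : `|sin t| = `|sin (t - n%:R * pi)|.
    by rewrite -(norm_sin_natpi n (t - _)) (addrC (n%:R * pi)) subrK.
  apply: lt_le_trans (ler_norm _).
  apply: (@lt_trans _ _ (0 * (t - n%:R * pi) + 1 / 2)).
    rewrite mul0r add0r; apply: lt_le_trans yN.
    by rewrite ltr_pM2l.
  apply: (@sin_gt_line _ _ (pi / 6) (5 * pi / 6)); rewrite ?mul0r ?add0r ?sin_pi6//; try lra.
  rewrite (_ : 5 * pi / 6 = pi / 2 + pi / 2 - pi / 6); last by field.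
  by rewrite -splitr addrC sinDpi sinN opprK sin_pi6.
- by move=> t [At]; rewrite /= in_itv/= => /andP[t0 tn]; lra.
- by lra.
Qed.

Lemma expR2_ge : 718 / 100 <= expR 2 :> R.
Proof.
rewrite -[2 : R]mulr1 expRM_natl.
by apply: sqr_lower_bound expR1_ge _; lra.
Qed.

(** There are three ranges. On [0.14, 0.19] and [0.0525, 0.14[ both sides are monotone in y, so the
    lobes are measured at the upper end and the Gaussian width is bounded at the lower end, with ln
    (1 / y) estimated by 2 and by 3. Below 0.0525 the number of lobes grows as y decreases. *)
Lemma gauss_width_le_distrib_sinc y : 0 < y -> y <= 19 / 100 ->
  ((gauss_width y)%:E <= distrib sinc y)%E.
Proof.
move=> y0 y19; have p0 := pi_gt314 (R := R); have p1 := pi_lt315 (R := R).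
have e2 := expR2_ge; have e1 := expR1_ge (R := R).
have e3 : 192 / 10 <= expR 3 :> R.
  have -> : expR 3 = expR 2 * expR 1 :> R by rewrite -expRD; congr expR; ring.
  have : 0 <= (expR 2 - 718 / 100) * (expR 1 - 268 / 100) :> R.
    by apply: mulr_ge0; lra.
  lra.
have mono a b : y <= b -> (a <= distrib (@sinc R) b)%E -> (a <= distrib (@sinc R) y)%E.
  by move=> yb /le_trans; apply; apply: le_distrib => //; exact: measurable_sinc.
have s3 x : 0 <= x -> x - x ^+ 3 / 6 <= sin x := @sin_ge_taylor3 R x.
have [y14|y14] := leP (14 / 100) y.
  have W : gauss_width y <= 2 * pi - 53 / 100 - 88 / 100 - 128 / 100.
    apply: (@gauss_width_le _ _ 2) => //; [lra|nra|nra].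
  apply: (mono _ _ y19).
  apply: (@le_trans _ _ (2 * pi - 53 / 100 - 88 / 100 - 128 / 100)%:E) => //.
  apply: (@distrib_sinc_two_lobes _ (53 / 100) (88 / 100) (128 / 100)); try lra.
  - by have := s3 (53 / 100); lra.
  - by have := s3 (88 / 100); lra.
  (* The cubic bound on sin is too weak at 1.28, so the quadratic bound on cos is used around pi /
     2. *)
  - rewrite (_ : 128 / 100 = pi / 2 - (pi / 2 - 128 / 100)); last by ring.
    rewrite -[in sin _](opprB (pi / 2 - _) (pi / 2)) sinN sinBpihalf opprK.
    by have := @cos_ge_taylor2 R (pi / 2 - 128 / 100); nra.
have [y05|y05] := leP (21 / 400) y.
  have W : gauss_width y <= 2 * pi - 40 / 100 - 56 / 100 - 88 / 100.
    apply: (@gauss_width_le _ _ 3) => //; [lra|nra|nra].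
  apply: (mono _ _ (ltW y14)).
  apply: (@le_trans _ _ (2 * pi - 40 / 100 - 56 / 100 - 88 / 100)%:E) => //.
  apply: (@distrib_sinc_two_lobes _ (40 / 100) (56 / 100) (88 / 100)); try lra.
  - by have := s3 (40 / 100); lra.
  - by have := s3 (56 / 100); lra.
  - by have := s3 (88 / 100); lra.
(* The largest number of lobes with y N pi <= 1/2; y < 21/400 makes it at least 3. The estimate of
   ln (1 / y) is then 2 + N. *)
pose N := Num.truncn (2 * pi * y)^-1.
have q0 : 0 < 2 * pi * y by rewrite mulr_gt0//; lra.
have /andP[N1 N2] : N%:R <= (2 * pi * y)^-1 < N.+1%:R.
  by apply: truncn_itv; rewrite invr_ge0 ltW.
have N3 : (3 <= N)%N.
  rewrite -ltnS -(ltr_nat R); apply: le_lt_trans N2.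
  rewrite -[leRHS]mul1r ler_pdivlMr//; nra.
have N3' : 3 <= N%:R :> R by rewrite (ler_nat R 3).
apply: le_trans (@distrib_sinc_many_lobes y N y0 _); last first.
  by move: N1; rewrite -[leRHS]mul1r ler_pdivlMr//; nra.
rewrite lee_fin; apply: (@gauss_width_le _ _ (2 + N%:R)) => //.
- by rewrite mulr_ge0//; lra.
(* Here e^N >= 1 + N and e^2 >= 7.18 > 2 pi, so y e^(2 + N) >= 2 pi y (N + 1) > 1. *)
- move: N2; rewrite -[ltLHS]mul1r ltr_pdivrMr// -natr1 => N2.
  rewrite expRD; move: (expR_ge1Dx (N%:R : R)); move: (expR N%:R) (expR 2) e2 => f e e2 f1.
  have h1 : 0 <= y * ((e - 718 / 100) * f).
    by apply: mulr_ge0; [lra|apply: mulr_ge0; lra].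
  have h2 : 0 <= y * (f - (1 + N%:R)) by apply: mulr_ge0; lra.
  have h3 : 0 <= (718 / 100 - 2 * pi) * (y * (N%:R + 1)).
    by apply: mulr_ge0; [lra|apply: mulr_ge0; lra].
  lra.
(* Divided by 2 pi, the claim is 2 + N <= (2 pi / 9) N^2, which for N = 3 reads 5 <= 2 pi. *)
- have : 2 * pi * (2 + N%:R) <= 2 * pi * (2 * 314 / 900 * N%:R ^+ 2).
    by rewrite ler_pM2l; nra.
  move=> /le_trans; apply.
  rewrite (_ : (N%:R * (2 * pi / 3)) ^+ 2 = 2 * pi * (2 * pi / 9 * N%:R ^+ 2)); last by field.
  rewrite ler_pM2l; last by lra.
  by rewrite ler_wpM2r ?sqr_ge0//; lra.
Qed.

Lemma distrib_sinc_le_width_quarter y : 1 / 4 <= y ->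
  (distrib sinc y <= (gauss_width y)%:E)%E.
Proof.
move=> y4; apply: distrib_sinc_le_width => [|t]; first by lra.
exact: superlevel_sinc_pi.
Qed.

Lemma sinc_gauss_crossing y z : 0 < z -> z < y ->
  ((gauss_width y)%:E < distrib sinc y)%E ->
  ((gauss_width z)%:E <= distrib sinc z)%E.
Proof.
move=> z0 zy hy.
have [z19|z19] := leP z (19 / 100); first exact: gauss_width_le_distrib_sinc.
have [y4|y4] := leP (1 / 4) y.
  by have := distrib_sinc_le_width_quarter y4; rewrite leNgt hy.
(* An excess over the Gaussian width at level y is impossible if only the main lobe reaches y. *)
have [t [pt At]] : exists t, pi <= t /\ superlevel sinc y t.
  apply: contrapT => /forallNP noA.
  have : (distrib sinc y <= (gauss_width y)%:E)%E.
    apply: distrib_sinc_le_width => [|t At]; first exact: lt_trans zy.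
    by rewrite ltNge; apply/negP => pt; exact: (noA t).
  by rewrite leNgt hy.
apply: le_trans (distrib_sinc_growth z0 zy pt At).
apply: (@le_trans _ _ (gauss_width y + 2 * ((y - z) / (34 / 100)))%:E).
  by rewrite lee_fin gauss_width_lipschitz// ltW.
by rewrite EFinD leeD2r// ltW.
Qed.

End crossing.

(** * Decreasing rearrangement *)

Section rearrangement.
Context {R : realType}.
Local Notation mu := (@lebesgue_measure R).
Local Notation D := (`]0%R, +oo[%classic : set R).
Implicit Types (h : R -> R) (s t u x y z : R).

Lemma rearr_le h s x : 0 < x -> (distrib h x <= s%:E)%E -> rearr h s <= x.
Proof. by move=> x0 hx; apply: ge_inf => //; exists 0 => y /= [/ltW]. Qed.

(** The existence hypothesis guards against the empty set, whose [inf] is 0. *)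
Lemma rearr_ge h s x :
  (exists y, 0 < y /\ (distrib h y <= s%:E)%E) ->
  (forall y, 0 < y -> (distrib h y <= s%:E)%E -> x <= y) -> x <= rearr h s.
Proof. by move=> [y hy] H; apply: lb_le_inf; [exists y | move=> z [z0 /H]; exact]. Qed.

Lemma rearr_ge0 h s : 0 <= rearr h s.
Proof.
have [hy|hy] := pselect (exists y, 0 < y /\ (distrib h y <= s%:E)%E).
  by apply: rearr_ge => // y /ltW.
rewrite /rearr (_ : [set _ | _] = set0) ?inf0//.
by apply/seteqP; split => // y hy'; apply: hy; exists y.
Qed.

Lemma lt_rearr h s x : 0 < x -> x < rearr h s -> (s%:E < distrib h x)%E.
Proof. by move=> x0; rewrite !ltNge; apply: contra; exact: rearr_le. Qed.

(** The rearrangement is nonincreasing on ]0, +oo[, so the preimage of a closed upper ray is an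
    interval. *)
Lemma measurable_rearr h :
  (forall s, 0 < s -> exists y, 0 < y /\ (distrib h y <= s%:E)%E) ->
  measurable_fun D (rearr h).
Proof.
move=> hh; apply: (measurability (@RGenCInfty.G R)) => [|/= _ [_] [r] -> <-].
  exact: RGenCInfty.measurableE.
apply: is_interval_measurable => s t/=.
rewrite !in_itv/= !andbT => -[s0 rs] [t0 rt] u /andP[su ut].
split; rewrite in_itv/= andbT; first exact: lt_le_trans su.
rewrite (le_trans rt)//.
apply: rearr_ge => [|y y0 hy]; first by apply: hh; exact: lt_le_trans su.
by apply: rearr_le => //; apply: (le_trans hy); rewrite lee_fin.
Qed.

Lemma measurable_hypograph (f : R -> R) : measurable_fun setT f ->
  measurable [set p : R * R | 0 < p.2 /\ p.2 < f p.1].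
Proof.
move=> mf.
rewrite (_ : [set _ | _] =
    [set p : R * R | 0 < p.2] `&` [set p : R * R | p.2 < f p.1]); last first.
  by apply/seteqP; split.
apply: measurableI.
+ have : measurable_fun setT (fun p : R * R => 0 < p.2).
    by apply: measurable_fun_ltr.
  by move=> /(_ measurableT [set true]); rewrite setTI; exact.
+ have : measurable_fun setT (fun p : R * R => p.2 < f p.1).
    by apply: measurable_fun_ltr => //; exact: measurableT_comp.
  by move=> /(_ measurableT [set true]); rewrite setTI; exact.
Qed.

Lemma ysection_hypograph (f : R -> R) (r : R) :
  ysection [set p : R * R | 0 < p.2 /\ p.2 < f p.1] r =
  [set x : R | 0 < r /\ r < f x].
Proof. by apply/seteqP; split => x; rewrite /ysection/= inE. Qed.

Lemma measurable_tail (f : R -> R) : measurable_fun setT f ->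
  measurable_fun setT (fun r : R => mu [set x : R | 0 < r /\ r < f x]).
Proof.
move=> mf; have := measurable_fun_ysection mu (measurable_hypograph mf).
by apply: eq_measurable_fun => r _ /=; rewrite ysection_hypograph.
Qed.

(** Tonelli applied to the region 0 < r < f x: its sections at fixed x are ]0, f x[, and those at
    fixed r are the sets on the right. *)
Lemma layer_cake (f : R -> R) : measurable_fun setT f -> (forall x, 0 <= f x) ->
  (\int[mu]_x (f x)%:E = \int[mu]_r mu [set x : R | (0 < r)%R /\ (r < f x)%R])%E.
Proof.
move=> mf f0; have mH := measurable_hypograph mf.
have := indic_fubini_tonelli mu mu mH.
rewrite indic_fubini_tonelli_FE// indic_fubini_tonelli_GE// => H.
transitivity (\int[mu]_x (mu \o xsection
    [set p : R * R | (0 < p.2)%R /\ (p.2 < f p.1)%R]) x)%E; last first.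
  by rewrite H; apply: eq_integral => r _ /=; rewrite ysection_hypograph.
apply: eq_integral => x _ /=.
rewrite (_ : xsection _ x = `]0%R, f x[%classic).
  by rewrite lebesgue_measure_oo// subr0.
by apply/seteqP; split => r; rewrite /xsection/= inE/= in_itv/= => /andP.
Qed.

(** By the layer cake formula it suffices to compare superlevel sets at height sqrt r. Where the
    rearrangement exceeds x at s, the distribution function at x exceeds s, so its superlevel set
    lies in an interval of length [distrib h x]. Functions are extended by 0 off [D] to apply the
    formula on the line. *)
Lemma integral_rearr_sqr_le h : measurable_fun D h ->
  (forall s, 0 < s -> exists y, 0 < y /\ (distrib h y <= s%:E)%E) ->
  (\int[mu]_(s in D) ((rearr h s) ^+ 2)%:E <= \int[mu]_(t in D) ((h t) ^+ 2)%:E)%E.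
Proof.
move=> mh hh.
have mD : measurable D by exact: measurable_itv.
have restr (f : R -> R) : (\int[mu]_(s in D) ((f s) ^+ 2)%:E =
    \int[mu]_s (((fun x => f x ^+ 2) \_ D) s)%:E)%E.
  by rewrite integral_mkcond; apply: eq_integral => x _; rewrite !patchE; case: ifP.
have mrestr (f : R -> R) : measurable_fun D f ->
    measurable_fun setT ((fun x => f x ^+ 2) \_ D).
  by move=> mf; apply: (measurable_restrictT _ mD).1; exact: measurable_funX.
have restr0 (f : R -> R) x : 0 <= ((fun x => f x ^+ 2) \_ D) x.
  by rewrite patchE; case: ifP => // _; exact: sqr_ge0.
have tailE (f : R -> R) r : 0 < r ->
    [set x | 0 < r /\ r < ((fun x => f x ^+ 2) \_ D) x] = superlevel f (Num.sqrt r).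
  move=> r0; apply/seteqP; split => x /=; rewrite patchE.
  + case: ifPn; rewrite ?inE ?notin_setE/= in_itv/= andbT.
      by move=> x0 [_ rf]; split=> //; rewrite -sqrtr_sqr ltr_sqrt// (lt_trans r0).
    by move=> _ [_]; rewrite ltNge (ltW r0).
  + move=> [x0 rf]; rewrite mem_set/= ?in_itv/= ?x0//; split=> //.
    by rewrite -(sqr_sqrtr (ltW r0)) -(real_normK (num_real (f x))) ltr_sqr// nnegrE.
have mg := measurable_rearr hh.
rewrite !restr !layer_cake//; try exact: mrestr.
apply: ge0_le_integral => //.
- by apply: (@measurable_tail ((fun x => rearr h x ^+ 2) \_ D)); exact: mrestr.
- by apply: (@measurable_tail ((fun x => h x ^+ 2) \_ D)); exact: mrestr.
move=> r _; have [r0|r0] := pselect (0 < r); last first.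
  rewrite (_ : [set _ | _] = set0) ?measure0//.
  by apply/seteqP; split => // x [].
have sr : 0 < Num.sqrt r by rewrite sqrtr_gt0.
rewrite !tailE// -/(distrib h _).
have sub x : superlevel (rearr h) (Num.sqrt r) x -> (x%:E < distrib h (Num.sqrt r))%E.
  by move=> [x0]; rewrite ger0_norm ?rearr_ge0//; exact: lt_rearr.
have dge0 : (0 <= distrib h (Num.sqrt r))%E by [].
change (mu (superlevel (rearr h) (Num.sqrt r)) <= distrib h (Num.sqrt r))%E.
case E : (distrib h (Num.sqrt r)) dge0 => [a| |]; [|by move=> _; exact: leey|by []].
rewrite lee_fin => a0; rewrite -[a]subr0 -lebesgue_measure_oo//.
apply: le_measure; rewrite ?inE.
- exact: measurable_superlevel.
- exact: measurable_itv.
- by move=> x rx; have := sub _ rx; rewrite E lte_fin /= in_itv/= (proj1 rx).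
Qed.

End rearrangement.

(** * Comparison of the rearrangement with the Gaussian *)

Section single_crossing.
Context {R : realType}.
Local Notation mu := (@lebesgue_measure R).
Local Notation pi := (@pi R).
Local Notation D := (`]0%R, +oo[%classic : set R).
Implicit Types (s t x y z q : R).

(** Evaluated at pi t it is exp (- pi t^2 / 2), the Gaussian attached to [sincpi]. *)
Definition gauss s : R := expR (- (s ^+ 2 / (2 * pi))).

Lemma gauss_gt0 s : 0 < gauss s. Proof. exact: expR_gt0. Qed.

Lemma gauss_lt s t : 0 <= s -> s < t -> gauss t < gauss s.
Proof.
move=> s0 st; have p0 := pi_gt0 R.
rewrite ltr_expR ltrN2 ltr_pM2r ?invr_gt0; last by lra.
by rewrite ltr_sqr ?nnegrE//; lra.
Qed.

Lemma gauss_gauss_width y : 0 < y -> y <= 1 -> gauss (gauss_width y) = y.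
Proof.
move=> y0 y1; have p0 := pi_gt0 R.
have l0 : 0 <= ln y^-1 by rewrite ln_ge0// invf_ge1.
rewrite /gauss sqr_sqrtr; last by rewrite mulr_ge0//; lra.
rewrite mulrC mulKf; last by rewrite gt_eqF//; lra.
by rewrite lnV ?posrE// opprK lnK// posrE.
Qed.

Lemma distrib_sinc_eq0 y : 1 <= y -> distrib (@sinc R) y = 0%E.
Proof.
move=> y1; apply/eqP; rewrite eq_le; apply/andP; split; last by [].
apply: (@le_trans _ _ (gauss_width y)%:E).
  by apply: distrib_sinc_le_width_quarter; lra.
rewrite lee_fin /gauss_width -[leRHS](@sqrtr0 R) ler_wsqrtr//.
have p0 := pi_gt0 R.
rewrite pmulr_rle0; last by lra.
by rewrite ln_le0// invf_le1//; lra.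
Qed.

Lemma distrib_sinc_finite s : 0 < s ->
  exists y, 0 < y /\ (distrib (@sinc R) y <= s%:E)%E.
Proof. by move=> s0; exists 1; rewrite distrib_sinc_eq0// lee_fin ltW. Qed.

Local Notation g := (rearr (@sinc R)).

(** The crossing level [y0] is the supremum of the levels where [distrib sinc] exceeds
    [gauss_width], and the crossing point is its width. Comparisons of distribution functions on
    either side of [y0] are inverted into comparisons of rearrangements. The first alternative is
    the case of no such level. *)
Lemma rearr_sinc_crossing :
  (forall s, 0 < s -> g s <= gauss s) \/
  exists t y, [/\ 0 < t, 0 < y,
    (forall s, 0 < s -> s <= t -> y <= g s /\ g s <= gauss s) &
    (forall s, t <= s -> gauss s <= g s /\ g s <= y)].
Proof.
pose E := [set y : R | 0 < y /\ ((gauss_width y)%:E < distrib sinc y)%E].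
have [[y1 [y10 y1E]]|noE] := pselect (exists y, E y); last first.
  left => s s0; apply: rearr_le; first exact: gauss_gt0.
  have [//|] := leP (distrib sinc (gauss s)) s%:E.
  rewrite -{1}(gauss_width_expR (ltW s0)) => H.
  by exfalso; apply: noE; exists (gauss s); split => //; exact: gauss_gt0.
right; pose y0 := sup E; pose t0 := gauss_width y0.
have ubE : ubound E (1 / 4).
  move=> y [y_gt0 hy]; rewrite leNgt; apply/negP => /ltW /distrib_sinc_le_width_quarter.
  by rewrite leNgt hy.
have supE : has_sup E by split; [exists y1|exists (1 / 4)].
have y0_gt0 : 0 < y0 by apply: (lt_le_trans y10); apply: ub_le_sup => //; exists (1 / 4).
have y0_le : y0 <= 1 / 4 by apply: ge_sup => //; exists y1.
have p0 := pi_gt0 R.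
have t0_gt0 : 0 < t0.
  by rewrite sqrtr_gt0 mulr_gt0 ?ln_gt0 ?invf_gt1//; lra.
have ft0 : gauss t0 = y0 by apply: gauss_gauss_width => //; lra.
have above y : y0 < y -> (distrib sinc y <= (gauss_width y)%:E)%E.
  move=> y0y; rewrite leNgt; apply/negP => hy.
  have : y <= y0 by apply: ub_le_sup; [exists (1 / 4)|split=> //; exact: lt_trans y0y].
  by rewrite leNgt y0y.
(* Some level of [E] lies strictly between y and the supremum or equals it, and
   [sinc_gauss_crossing] carries its excess down to y. *)
have below y : 0 < y -> y < y0 -> ((gauss_width y)%:E <= distrib sinc y)%E.
  move=> y_gt0 yy0.
  have [|z [_ zE] yz] := sup_adherent (_ : 0 < y0 - y) supE; first by rewrite subr_gt0.
  rewrite -/y0 subKr in yz.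
  exact: sinc_gauss_crossing zE.
have g_ge s : 0 < s -> s <= t0 -> y0 <= g s.
  move=> s0 st; apply: rearr_ge; first exact: distrib_sinc_finite.
  move=> y y_gt0 hy; rewrite leNgt; apply/negP => yy0.
  have := le_trans (below y y_gt0 yy0) hy; rewrite lee_fin leNgt => /negP; apply.
  by apply: (le_lt_trans st); apply: gauss_width_lt => //; lra.
(* [above] holds only strictly above [y0], hence the passage through y0 + e. *)
have g_le s : t0 <= s -> g s <= y0.
  move=> ts; apply/ler_addgt0Pr => e e0; apply: rearr_le; first by rewrite addr_gt0.
  have y0e : y0 < y0 + e by rewrite ltrDl.
  apply: (le_trans (above _ y0e)); rewrite lee_fin (le_trans _ ts)// ltW//.
  by apply: gauss_width_lt => //; lra.
exists t0, y0; split => //.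
- move=> s s0 st; split; first exact: g_ge.
  move: st; rewrite le_eqVlt => /predU1P[->|st]; first by rewrite ft0 g_le.
  apply: rearr_le; first exact: gauss_gt0.
  rewrite -[in leRHS](gauss_width_expR (ltW s0)); apply: above.
  by rewrite -ft0; apply: gauss_lt => //; exact: ltW.
- move=> s ts; split; last exact: g_le.
  move: ts; rewrite le_eqVlt => /predU1P[<-|ts]; first by rewrite ft0 g_ge.
  have s0 : 0 < s by exact: lt_trans ts.
  apply: rearr_ge; first exact: distrib_sinc_finite.
  move=> y y_gt0 hy; rewrite leNgt; apply/negP => yf.
  have yy0 : y < y0 by rewrite -ft0; apply: (lt_trans yf); apply: gauss_lt => //; exact: ltW.
  have := le_trans (below y y_gt0 yy0) hy; rewrite lee_fin leNgt => /negP; apply.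
  rewrite -[ltLHS](gauss_width_expR (ltW s0)); apply: gauss_width_lt => //; lra.
Qed.

(* Monotonicity of [x^q - (q/2) y^(q-2) x^2] on either side of its critical
   point [y]. *)
Lemma powR_sqr_compare q y a b : 2 <= q -> 0 < y -> 0 < a -> a <= b ->
  (y <= a -> q / 2 * y `^ (q - 2) * (b ^+ 2 - a ^+ 2) <= b `^ q - a `^ q) /\
  (b <= y -> b `^ q - a `^ q <= q / 2 * y `^ (q - 2) * (b ^+ 2 - a ^+ 2)).
Proof.
move=> q2 y0 a0 ab; set k := q / 2 * y `^ (q - 2).
pose f' x := q * x * (x `^ (q - 2) - y `^ (q - 2)).
have df x : 0 < x -> is_derive x 1 (fun x => x `^ q - k * x ^+ 2) (f' x).
  move=> x0; have dq := is_derive1_powR q x0.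
  apply: is_derive_eq; rewrite /GRing.scale/= /f' /k.
  have -> : x `^ (q - 1) = x * x `^ (q - 2).
    rewrite (_ : q - 2 = (q - 1) - 1); last by ring.
    have [q1|q1] := eqVneq q 1; first by lra.
    by rewrite mulr_powRB1 ?(ltW x0)//; lra.
  by field.
have q0 : 0 <= q - 2 by lra.
split => [ya|yb].
- suff : a `^ q - k * a ^+ 2 <= b `^ q - k * b ^+ 2 by lra.
  apply: (@ge0_derive_ge R (fun x => x `^ q - k * x ^+ 2) f') => // x /andP[ax xb].
    by apply: df; exact: lt_le_trans ax.
  rewrite /f' mulr_ge0//; first by rewrite mulr_ge0; lra.
  by rewrite subr_ge0 ge0_ler_powR// ?nnegrE; lra.
- suff : - (a `^ q - k * a ^+ 2) <= - (b `^ q - k * b ^+ 2) by lra.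
  apply: (@ge0_derive_ge R (fun x => - (x `^ q - k * x ^+ 2)) (fun x => - f' x)) => // x /andP[ax xb].
    by apply: is_deriveN; apply: df; exact: lt_le_trans ax.
  rewrite oppr_ge0 /f' mulr_ge0_le0//; first by rewrite mulr_ge0; lra.
  by rewrite subr_le0 ge0_ler_powR// ?nnegrE; lra.
Qed.

(** Since al <= 1 the weight s^(al - 1) is nonincreasing. Replacing it by its value at the crossing
    point lowers it where the Gaussian is above and raises it where [g] is above, so in both regions
    [powR_sqr_compare] gives the inequality with the same K. Without a crossing K = 0 works. *)
Lemma rearr_sinc_pointwise q al : 2 <= q -> 0 < al -> al <= 1 ->
  exists K : R, 0 <= K /\ forall s, 0 < s ->
   g s `^ q * s `^ (al - 1) + K * gauss s ^+ 2 <=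
   gauss s `^ q * s `^ (al - 1) + K * g s ^+ 2.
Proof.
move=> q2 al0 al1; have q0 : 0 <= q by lra.
have [le_g|[t [y [t0 y0 small large]]]] := rearr_sinc_crossing.
  exists 0; split => // s s0; rewrite !mul0r !addr0 ler_wpM2r ?powR_ge0//.
  by rewrite ge0_ler_powR ?nnegrE ?rearr_ge0 ?(ltW (gauss_gt0 s))// le_g.
set k := q / 2 * y `^ (q - 2).
have k0 : 0 <= k by rewrite mulr_ge0 ?powR_ge0//; lra.
exists (t `^ (al - 1) * k); split; first by rewrite mulr_ge0 ?powR_ge0.
move=> s s0.
have w_mono a b : 0 < a -> a <= b -> b `^ (al - 1) <= a `^ (al - 1).
  move=> a0 ab; rewrite -(opprB 1 al) !powRN lef_pV2 ?posrE ?powR_gt0//; last exact: lt_le_trans ab.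
  by rewrite ge0_ler_powR ?nnegrE//; lra.
have wt := powR_ge0 t (al - 1).
have [st|/ltW ts] := leP s t.
- have [yg gf] := small s s0 st.
  have [h _] := powR_sqr_compare q2 y0 (lt_le_trans y0 yg) gf.
  have {}h := h yg; rewrite -/k in h.
  have w := w_mono _ _ s0 st.
  have d : 0 <= k * (gauss s ^+ 2 - g s ^+ 2).
    rewrite mulr_ge0// subr_ge0 ler_sqr ?nnegrE ?rearr_ge0//.
    exact/ltW/gauss_gt0.
  have : t `^ (al - 1) * (k * (gauss s ^+ 2 - g s ^+ 2)) <=
         s `^ (al - 1) * (gauss s `^ q - g s `^ q).
    by apply: ler_pM => //.
  lra.
- have [fg gy] := large s ts.
  have [_ h] := powR_sqr_compare q2 y0 (gauss_gt0 s) fg.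
  have {}h := h gy; rewrite -/k in h.
  have w := w_mono _ _ t0 ts.
  have d : 0 <= g s `^ q - gauss s `^ q.
    rewrite subr_ge0 ge0_ler_powR ?nnegrE ?rearr_ge0//.
    exact/ltW/gauss_gt0.
  have : s `^ (al - 1) * (g s `^ q - gauss s `^ q) <=
         t `^ (al - 1) * (k * (g s ^+ 2 - gauss s ^+ 2)).
    by apply: ler_pM => //; exact: powR_ge0.
  lra.
Qed.

Lemma measurable_gauss : measurable_fun D gauss.
Proof.
apply: measurable_funTS; apply: continuous_measurable_fun => x.
rewrite /gauss; apply: continuous_comp; last exact: continuous_expR.
apply: continuousN; apply: continuousM; last exact: cst_continuous.
exact: exprn_continuous.
Qed.

Lemma rearr_sinc_lorentz_le q al : 2 <= q -> 0 < al -> al <= 1 ->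
  (\int[mu]_(t in D) ((sinc t) ^+ 2)%:E <= \int[mu]_(t in D) ((gauss t) ^+ 2)%:E)%E ->
  (\int[mu]_(t in D) ((gauss t) ^+ 2)%:E < +oo)%E ->
  (\int[mu]_(t in D) (g t `^ q * t `^ (al - 1))%:E <=
   \int[mu]_(t in D) (gauss t `^ q * t `^ (al - 1))%:E)%E.
Proof.
move=> q2 al0 al1 sinc_le fin.
have [K [K0 pw]] := rearr_sinc_pointwise q2 al0 al1.
have mD : measurable D by exact: measurable_itv.
have mg : measurable_fun D g := measurable_rearr distrib_sinc_finite.
have mf := measurable_gauss.
have mw (h : R -> R) : measurable_fun D h ->
    measurable_fun D (fun t => (h t `^ q * t `^ (al - 1))%:E).
  move=> mh; apply/measurable_EFinP; apply: measurable_funM.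
    exact: (measurableT_comp (measurable_powR q)).
  exact: measurable_funTS.
have m2 (h : R -> R) : measurable_fun D h ->
    measurable_fun D (fun t => (h t ^+ 2)%:E).
  by move=> mh; apply/measurable_EFinP; exact: measurable_funX.
have g_le := le_trans (integral_rearr_sqr_le (@measurable_sinc R) distrib_sinc_finite) sinc_le.
set If := (\int[mu]_(t in D) ((gauss t) ^+ 2)%:E)%E in sinc_le fin g_le *.
have If0 : (0 <= If)%E by apply: integral_ge0 => t _; rewrite lee_fin sqr_ge0.
have Iffin : If \is a fin_num by rewrite ge0_fin_numE.
(* K times the integral of gauss^2 is added to both sides; it is finite, so it can be cancelled. *)
rewrite -(@leeD2rE _ (K%:E * If)%E); last by rewrite fin_numM.
apply: (@le_trans _ _ (\int[mu]_(t in D) (gauss t `^ q * t `^ (al - 1))%:E +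
   K%:E * \int[mu]_(t in D) ((g t) ^+ 2)%:E)%E); last first.
  by rewrite leeD2l// lee_wpmul2l ?lee_fin.
have sumE (h k : R -> R) : measurable_fun D h -> measurable_fun D k ->
    (\int[mu]_(t in D) (h t `^ q * t `^ (al - 1))%:E +
     K%:E * \int[mu]_(t in D) (k t ^+ 2)%:E =
     \int[mu]_(t in D) (h t `^ q * t `^ (al - 1) + K * k t ^+ 2)%:E)%E.
  move=> mh mk; rewrite -ge0_integralZl_EFin//; first last.
  - exact: m2.
  - by move=> t _; rewrite lee_fin sqr_ge0.
  rewrite -ge0_integralD//.
  - by move=> t _; rewrite lee_fin mulr_ge0 ?powR_ge0.
  - exact: mw.
  - by move=> t _; rewrite -EFinM lee_fin mulr_ge0 ?sqr_ge0.
  - by apply: measurable_funeM; exact: m2.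
have msum (h k : R -> R) : measurable_fun D h -> measurable_fun D k ->
    measurable_fun D (fun t => (h t `^ q * t `^ (al - 1) + K * k t ^+ 2)%:E).
  move=> mh mk; apply/measurable_EFinP; apply: measurable_funD.
    by have /measurable_EFinP := mw _ mh.
  by apply: measurable_funM => //; exact: measurable_funX.
rewrite [leLHS](sumE _ _ mg mf) [leRHS](sumE _ _ mf mg).
apply: ge0_le_integral.
- exact: mD.
- move=> t _; rewrite lee_fin.
  by apply: addr_ge0; apply: mulr_ge0; rewrite ?powR_ge0 ?sqr_ge0.
- exact: msum.
- exact: msum.
- by move=> t; rewrite /= in_itv/= andbT lee_fin => /pw.
Qed.

End single_crossing.

(** * Integrals of sinc and of Gaussians *)

Section scaling.
Context {R : realType}.
Local Notation mu := (@lebesgue_measure R).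
Local Notation D := (`]0%R, +oo[%classic : set R).
Implicit Types (c a b s t x y z : R).

Lemma preimage_mul_itv c a b : 0 < c ->
  ( *%R c) @^-1` `]a, b]%classic = `]a / c, b / c]%classic.
Proof.
move=> c0; apply/seteqP; split => x /=; rewrite !in_itv/= ler_pdivlMr// ltr_pdivrMr//;
  by rewrite (mulrC x).
Qed.

Lemma measurable_mul c : measurable_fun [set: R] ( *%R c).
Proof. exact: mulrl_measurable. Qed.

(** The right side is a measure in A, namely c times the pushforward under x -> c x, and it agrees
    with Lebesgue measure on half-open intervals; uniqueness concludes. *)
Lemma lebesgue_measure_mul c (A : set R) : 0 < c -> measurable A ->
  (mu A = c%:E * mu (( *%R c) @^-1` A))%E.
Proof.
move=> c0 mA.
have mc : measurable_fun [set: measurableTypeR R] (( *%R c) : measurableTypeR R -> measurableTypeR R).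
  exact: measurable_mul.
pose m : {measure set (measurableTypeR R) -> \bar R} :=
  mscale (NngNum (ltW c0)) (measure_function_pushforward__canonical__measure_function_Measure mu mc).
rewrite (_ : (c%:E * mu (( *%R c) @^-1` A))%E = m A)//.
apply: (@lebesgue_measure_unique R m) => // _ [[a b]] _ <-/=.
rewrite /m /= /mscale/= /pushforward.
rewrite preimage_mul_itv// !lebesgue_measure_itv/= !lte_fin.
rewrite ltr_pM2r ?invr_gt0//; case: ifP => _; last by rewrite mule0.
by rewrite -!EFinB -EFinM -mulrBl mulrCA divff ?mulr1// gt_eqF.
Qed.

Lemma ge0_integral_mul c (F : R -> \bar R) : 0 < c -> measurable_fun D F ->
  (forall x, 0 < x -> (0 <= F x)%E) ->
  (\int[mu]_(x in D) F x = c%:E * \int[mu]_(x in D) F (c * x)%R)%E.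
Proof.
move=> c0 mF F0.
have mD : measurable D by exact: measurable_itv.
have mc : measurable_fun [set: measurableTypeR R] (( *%R c) : measurableTypeR R -> measurableTypeR R).
  exact: measurable_mul.
have cD : ( *%R c) @^-1` D = D.
  by apply/seteqP; split => x; rewrite /= !in_itv/= !andbT pmulr_rgt0.
pose m := measure_function_pushforward__canonical__measure_function_Measure mu mc.
have F0' x : D x -> (0 <= F x)%E by rewrite /= in_itv/= andbT => /F0.
transitivity (\int[mscale (NngNum (ltW c0)) m]_(x in D) F x)%E.
  apply: eq_measure_integral => A mA _ /=.
  by rewrite /mscale/= /pushforward -lebesgue_measure_mul.
rewrite ge0_integral_mscale//= ge0_integral_pushforward//; last first.
  by move=> y /set_mem /F0'.
by rewrite cD.
Qed.

(** Monotone convergence along [1 / (n + 2), n + 2]. It reduces integrals over the half-line to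
    compact intervals away from 0; the shift by 2 makes the endpoints distinct. *)
Lemma ge0_integral_exhaust (F : R -> R) (M : \bar R) : measurable_fun D F ->
  (forall x, 0 < x -> 0 <= F x) ->
  (forall a b, 0 < a -> a < b -> (\int[mu]_(x in `[a, b]) (F x)%:E <= M)%E) ->
  (\int[mu]_(x in D) (F x)%:E <= M)%E.
Proof.
move=> mF F0 H.
pose I n := (`[n.+2%:R^-1, n.+2%:R]%classic : set R).
have n0 n : 0 < n.+2%:R^-1 :> R by rewrite invr_gt0.
have ID n : I n `<=` D.
  by move=> x; rewrite /I /= !in_itv/= andbT => /andP[/(lt_le_trans (n0 n))].
have UI : \bigcup_n I n = D.
  apply/seteqP; split => [x [n _]|x]; first exact: ID.
  rewrite /= in_itv/= andbT => x0.
  exists (Num.truncn x + Num.truncn x^-1)%N => //; rewrite /I /= in_itv/=.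
  have h y : 0 < y -> y < (Num.truncn y).+1%:R.
    by move=> y0; have /andP[] := truncn_itv (ltW y0).
  apply/andP; split.
    rewrite -[leRHS]invrK lef_pV2 ?posrE ?invr_gt0//.
    apply: (le_trans (ltW (h x^-1 _))); first by rewrite invr_gt0.
    by rewrite ler_nat; lia.
  apply: (le_trans (ltW (h x _))) => //.
  by rewrite ler_nat; lia.
have cv : (\int[mu]_(x in I n) (F x)%:E @[n --> \oo] -->
    \int[mu]_(x in \bigcup_n I n) (F x)%:E)%E.
  apply: ge0_nondecreasing_set_cvg_integral.
  - move=> n m nm; apply/subsetPset => x; rewrite /I /= !in_itv/= => /andP[nx xn].
    apply/andP; split.
      by apply: le_trans nx; rewrite lef_pV2 ?posrE// ler_nat !ltnS.
    by apply: (le_trans xn); rewrite ler_nat !ltnS.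
  - by move=> n; exact: measurable_itv.
  - by move=> n; apply/measurable_EFinP; exact: measurable_funS mF.
  - by move=> n x /ID; rewrite /= in_itv/= andbT lee_fin => /F0.
rewrite UI in cv; rewrite -(cvg_lim _ cv)//; apply: lime_le.
  by apply/cvg_ex; eexists; exact: cv.
apply: nearW => n; apply: H => //.
rewrite -[ltRHS]invrK ltf_pV2 ?posrE ?invr_gt0//.
by apply: (@lt_trans _ _ 1); rewrite ?invf_lt1 ?ltr1n.
Qed.

Lemma integral_derive (f F : R -> R) a b : a < b -> continuous f ->
  (forall x, is_derive x 1 F (f x)) ->
  (\int[mu]_(x in `[a, b]) (f x)%:E = (F b - F a)%:E)%E.
Proof.
move=> ab cf dF.
have cF : continuous F.
  by move=> x; apply/differentiable_continuous/derivable1_diffP; have [] := dF x.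
rewrite (@continuous_FTC2 _ f F)//.
- exact: continuous_subspaceT.
- split.
  + by move=> x _; have [] := dF x.
  + by apply: cvg_at_right_filter; exact: cF.
  + by apply: cvg_at_left_filter; exact: cF.
- by move=> x _; rewrite derive1E; apply: derive_val; exact: dF.
Qed.

End scaling.

(** * The Fejer kernel and the square integral of sinc *)

Section fejer.
Context {R : realType}.
Local Notation mu := (@lebesgue_measure R).
Local Notation pi := (@pi R).
Local Notation D := (`]0%R, +oo[%classic : set R).
Implicit Types (a b t x : R).

(** The kernel sin ((2 n + 1) x) / sin x written as a cosine sum, which is continuous everywhere and
    has a termwise primitive. *)
Fixpoint dirichlet n x : R :=
  if n is m.+1 then dirichlet m x + 2 * cos (2 * m.+1%:R * x) else 1.

(** The unnormalised Fejer kernel sin^2 (n x) / sin^2 x, as a sum of Dirichlet kernels. *)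
Fixpoint fejer n x : R := if n is m.+1 then fejer m x + dirichlet m x else 0.

Fixpoint dirichlet_primitive n x : R :=
  if n is m.+1 then dirichlet_primitive m x + sin (2 * m.+1%:R * x) / m.+1%:R else x.

Fixpoint fejer_primitive n x : R :=
  if n is m.+1 then fejer_primitive m x + dirichlet_primitive m x else 0.

Lemma dirichlet_sin n x : dirichlet n x * sin x = sin ((2 * n%:R + 1) * x).
Proof.
elim: n => [|n IH] /=; first by rewrite mulr0 add0r !mul1r.
rewrite mulrDl IH (_ : n.+1%:R = n%:R + 1); last by rewrite natr1.
rewrite (_ : (2 * n%:R + 1) * x = 2 * (n%:R + 1) * x - x); last by ring.
rewrite (_ : (2 * (n%:R + 1) + 1) * x = 2 * (n%:R + 1) * x + x); last by ring.
by rewrite sinB sinD; ring.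
Qed.

(** The induction step is sin^2 ((n + 1) x) - sin^2 (n x) = sin ((2 n + 1) x) sin x. With sin x
    expanded as the sine of (n + 1) x - n x, it becomes polynomial modulo cos^2 + sin^2 = 1. *)
Lemma fejer_sin n x : fejer n x * sin x ^+ 2 = sin (n%:R * x) ^+ 2.
Proof.
elim: n => [|n IH] /=; first by rewrite !mul0r sin0 expr0n.
rewrite mulrDl IH expr2 mulrA dirichlet_sin (_ : n.+1%:R = n%:R + 1); last by rewrite natr1.
rewrite (_ : (2 * n%:R + 1) * x = (n%:R * x) + (n%:R * x + x)); last by ring.
rewrite (_ : (n%:R + 1) * x = n%:R * x + x); last by ring.
rewrite sinD.
have -> : sin x = sin (n%:R * x + x) * cos (n%:R * x) - cos (n%:R * x + x) * sin (n%:R * x).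
  by rewrite -sinB addrC addKr.
have := cos2sin2 (n%:R * x); have := cos2sin2 (n%:R * x + x).
move: (sin (n%:R * x)) (cos (n%:R * x)) (sin (n%:R * x + x)) (cos (n%:R * x + x)).
move=> s c S C hC hc.
transitivity (s ^+ 2 + S ^+ 2 * c ^+ 2 - C ^+ 2 * s ^+ 2); first by ring.
by rewrite hC hc; ring.
Qed.

Lemma is_derive_dirichlet_primitive n x :
  is_derive x 1 (dirichlet_primitive n) (dirichlet n x).
Proof.
elim: n => [|n IH] /=; first exact: is_derive_id.
apply: is_derive_eq; rewrite /GRing.scale/=.
have : n.+1%:R != 0 :> R by rewrite pnatr_eq0.
by move: n.+1%:R => m m0; field.
Qed.

Lemma is_derive_fejer_primitive n x : is_derive x 1 (fejer_primitive n) (fejer n x).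
Proof.
elim: n => [|n IH] /=; first exact: is_derive_cst.
by have h := is_derive_dirichlet_primitive n x; exact: is_deriveD.
Qed.

Lemma continuous_dirichlet n : continuous (dirichlet n).
Proof.
elim: n => [|n IH] x /=; first exact: cst_continuous.
apply: continuousD; first exact: IH.
apply: continuousM; first exact: cst_continuous.
apply: (@continuous_comp _ _ _ (fun x => 2 * n.+1%:R * x) (@cos R)).
  exact: mulrl_continuous.
exact: continuous_cos.
Qed.

Lemma continuous_fejer n : continuous (fejer n).
Proof.
elim: n => [|n IH] x /=; first exact: cst_continuous.
by apply: continuousD; [exact: IH | exact: continuous_dirichlet].
Qed.

Lemma fejer_primitive0 n : fejer_primitive n 0 = 0.
Proof.
have h m : dirichlet_primitive m 0 = 0.
  by elim: m => //= m ->; rewrite mulr0 sin0 mul0r addr0.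
by elim: n => //= n ->; rewrite h addr0.
Qed.

(** At pi / 2 every sine term is the sine of a multiple of pi, so each of the n Dirichlet kernels
    contributes pi / 2. *)
Lemma fejer_primitive_pihalf n : fejer_primitive n (pi / 2) = n%:R * (pi / 2).
Proof.
have h m : dirichlet_primitive m (pi / 2) = pi / 2.
  elim: m => //= m ->.
  rewrite (_ : 2 * m.+1%:R * (pi / 2) = 0 + pi *+ m.+1); last first.
    by rewrite -mulr_natr; field.
  by rewrite (alternatingn (@sinDpi R)) sin0 mulr0 mul0r addr0.
elim: n => /= [|n ->]; first by rewrite mul0r.
by rewrite h (_ : n.+1%:R = n%:R + 1) ?natr1//; ring.
Qed.

(** With x = n y, the bound sin y <= y replaces y^2 by sin^2 y in the denominator of sin^2 (n y) /
    (n y)^2. *)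
Lemma sinc_sqr_le_fejer n x : (0 < n)%N -> 0 < x -> x < n%:R * (pi / 2) ->
  sinc x ^+ 2 <= fejer n (n%:R^-1 * x) / n%:R ^+ 2.
Proof.
move=> n0 x0 xn; have p0 := pi_gt0 R.
have n0' : 0 < n%:R :> R by rewrite ltr0n.
set y := n%:R^-1 * x.
have xE : x = n%:R * y by rewrite /y mulVKf// gt_eqF.
have y0 : 0 < y by rewrite /y mulr_gt0 ?invr_gt0.
have yp : y < pi / 2 by rewrite -(ltr_pM2l n0') -xE.
have s0 : 0 < sin y by apply: sin_gt0_pi; lra.
have -> : fejer n y = sin x ^+ 2 / sin y ^+ 2.
  by rewrite xE -fejer_sin mulfK// gt_eqF// exprn_gt0.
rewrite /sinc expr_div_n -mulrA ler_wpM2l ?sqr_ge0//.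
rewrite -invfM lef_pV2 ?posrE ?mulr_gt0 ?exprn_gt0//.
rewrite xE exprMn mulrC ler_wpM2l ?sqr_ge0// ler_sqr ?nnegrE; [|exact: ltW..].
by rewrite sin_le_id// ltW.
Qed.

Lemma integral_sinc_sqr_le :
  (\int[mu]_(t in D) ((sinc t) ^+ 2)%:E <= (pi / 2)%:E)%E.
Proof.
have p2 := pi_ge2 R.
have m2 : measurable_fun D (fun t => sinc t ^+ 2).
  by apply: measurable_funX; exact: measurable_sinc.
apply: ge0_integral_exhaust => //; first by move=> x _; exact: sqr_ge0.
move=> a b a0 ab.
(* Any n > b places [a, b] inside ]0, n pi / 2[, because pi / 2 >= 1; the rescaled kernel [f] has
   integral pi / 2 there whatever n is. *)
pose n := (Num.truncn b).+1.
have b0 : 0 < b by exact: lt_trans ab.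
have bn : b < n%:R by have /andP[] := truncn_itv (ltW b0).
have bnp : b < n%:R * (pi / 2).
  by apply: (lt_le_trans bn); rewrite ler_peMr//; lra.
have n0 : 0 < n%:R :> R by [].
pose f x := fejer n (n%:R^-1 * x) / n%:R ^+ 2.
pose F x := fejer_primitive n (n%:R^-1 * x) / n%:R.
have cf : continuous f.
  move=> x.
  apply: (@continuousM _ _ (fun x => fejer n (n%:R^-1 * x)) (cst (n%:R ^+ 2)^-1) x);
    last exact: cst_continuous.
  apply: (@continuous_comp _ _ _ (fun x => n%:R^-1 * x) (fejer n)).
    exact: mulrl_continuous.
  exact: continuous_fejer.
have dF x : is_derive x 1 F (f x).
  have h := is_derive_fejer_primitive n (n%:R^-1 * x).
  have hl : is_derive x 1 (fun x => n%:R^-1 * x) n%:R^-1.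
    by apply: is_derive_eq; rewrite /GRing.scale/=; ring.
  have hc := is_derive1_comp h hl.
  apply: (is_derive_eq (is_deriveM hc (is_derive_cst (n%:R^-1 : R) x 1))).
  by rewrite /f /GRing.scale/= mulr0 add0r expr2 invfM mulrCA.
have fge x : 0 < x -> x < n%:R * (pi / 2) -> sinc x ^+ 2 <= f x.
  exact: sinc_sqr_le_fejer.
pose c : R := n%:R * (pi / 2).
have c0 : 0 < c by rewrite /c mulr_gt0//; lra.
have IF : (\int[mu]_(x in `[0%R, c]) (f x)%:E = (pi / 2)%:E)%E.
  rewrite (integral_derive c0 cf dF) /c.
  rewrite /F mulr0 fejer_primitive0 mul0r subr0 mulKf ?gt_eqF//.
  by rewrite fejer_primitive_pihalf mulrAC divff ?mul1r// gt_eqF.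
have mf (A : set R) : measurable A -> measurable_fun A f.
  by move=> mA; apply: measurable_funTS; exact: continuous_measurable_fun.
have <- : (\int[mu]_(x in `]0%R, c[) (f x)%:E = (pi / 2)%:E)%E.
  by rewrite -IF [RHS]integral_itv_bndoo//; apply/measurable_EFinP; exact: mf.
apply: (@le_trans _ _ (\int[mu]_(x in `[a, b]) (f x)%:E)%E).
  apply: ge0_le_integral.
  - exact: measurable_itv.
  - by move=> x _; rewrite lee_fin sqr_ge0.
  - apply/measurable_EFinP; apply: measurable_funS m2 => // x.
    by rewrite /= !in_itv/= andbT => /andP[/(lt_le_trans a0)].
  - by apply/measurable_EFinP; apply: mf; exact: measurable_itv.
  - move=> x; rewrite /= in_itv/= => /andP[ax xb]; rewrite lee_fin.
    by apply: fge; [exact: lt_le_trans ax|exact: le_lt_trans xb _].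
apply: ge0_subset_integral; [exact: measurable_itv|exact: measurable_itv| | |].
- by apply/measurable_EFinP; apply: mf; exact: measurable_itv.
- move=> x; rewrite /= in_itv/= => /andP[x0 xn]; rewrite lee_fin.
  by apply: le_trans (fge _ x0 xn); exact: sqr_ge0.
- move=> x; rewrite /= !in_itv/= => /andP[ax xb].
  by rewrite (lt_le_trans a0 ax) (le_lt_trans xb bnp).
Qed.

End fejer.

(** * Gaussian integrals *)

Section gaussian.
Context {R : realType}.
Local Notation mu := (@lebesgue_measure R).
Local Notation pi := (@pi R).
Local Notation D := (`]0%R, +oo[%classic : set R).
Implicit Types (a b c q t x : R).

(** The square is exp (- t^2 / pi), so a dilation by sqrt pi reduces it to the integral of exp (-
    u^2), which is sqrt pi / 2. *)
Lemma integral_gauss_sqr :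
  (\int[mu]_(t in D) ((gauss t) ^+ 2)%:E = (pi / 2)%:E)%E.
Proof.
have p0 := pi_gt0 R.
have c0 : 0 < (Num.sqrt pi)^-1 by rewrite invr_gt0 sqrtr_gt0.
have mg : measurable_fun D (EFin \o @gauss_fun R).
  by apply/measurable_EFinP; apply: measurable_funTS; exact: measurable_gauss_fun.
have := @integral0y_gauss R.
rewrite -(integral_itv_obnd_cbnd mg) (ge0_integral_mul c0 mg); last first.
  by move=> x _; rewrite lee_fin gauss_fun_ge0.
have -> : (\int[mu]_(x in D) (EFin \o gauss_fun) ((Num.sqrt pi)^-1 * x)%R =
           \int[mu]_(t in D) ((gauss t) ^+ 2)%:E)%E.
  apply: eq_integral => x _ /=; congr (_%:E).
  rewrite /gauss_fun /gauss -expRM_natl; congr expR.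
  rewrite exprMn exprVn sqr_sqrtr ?(ltW p0)//.
  have : pi != 0 by rewrite gt_eqF.
  by move: pi => p pn; field.
move=> h; rewrite -[LHS]mul1e.
have -> : 1%E = ((Num.sqrt pi)%:E * ((Num.sqrt pi)^-1)%:E)%E :> \bar R.
  by rewrite -EFinM divff// gt_eqF// sqrtr_gt0.
rewrite -muleA h -EFinM; congr (_%:E).
by rewrite mulrA -expr2 sqr_sqrtr// ltW.
Qed.

(* Substitution [u = c t^2]. *)
Lemma integral_gauss_powR_le c b : 0 < c -> 0 < b ->
  (\int[mu]_(t in D) (expR (- (c * t ^+ 2)) * t `^ (2 * b - 1))%:E <=
   (2^-1 * c `^ (- b))%:E * GammaE b)%E.
Proof.
move=> c0 b0.
pose G u : R := u `^ (b - 1) * expR (- u).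
pose F t : R := c * t ^+ 2.
have dF t : is_derive t 1 F (2 * c * t).
  by apply: is_derive_eq; rewrite /GRing.scale/=; ring.
have F'E : F^`()%classic = (fun t => 2 * c * t).
  by apply/funext => t; rewrite derive1E; apply: derive_val; exact: dF.
have cG u : 0 < u -> {for u, continuous G}.
  move=> u0; apply: continuousM.
    have := is_derive1_powR (b - 1) u0 => -[+ _].
    by move=> /derivable1_diffP/differentiable_continuous.
  apply: continuous_comp; first exact: continuousN.
  exact: continuous_expR.
have mD : measurable D by exact: measurable_itv.
have mG : measurable_fun [set: R] G.
  apply: measurable_funM; first exact: measurable_powR.
  apply: continuous_measurable_fun => u.
  apply: continuous_comp; first exact: continuousN.
  exact: continuous_expR.
have G0 u : 0 <= G u by rewrite mulr_ge0 ?powR_ge0 ?expR_ge0.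
have intE t : 0 < t -> expR (- (c * t ^+ 2)) * t `^ (2 * b - 1) =
    2^-1 * c `^ (- b) * (G (F t) * (2 * c * t)).
  move=> t0; have t2 : t ^+ 2 = t `^ 2 by rewrite powR_mulrn// ltW.
  rewrite /G /F powRM ?sqr_ge0 ?(ltW c0)// t2 -powRrM -t2.
  have -> : t `^ (2 * b - 1) = t `^ (2 * (b - 1)) * t.
    rewrite -[X in _ = _ * X](powRr1 (ltW t0)) -powRD;
      last by apply/implyP => _; rewrite gt_eqF.
    by congr (_ `^ _); ring.
  have cb : c `^ (- b) * (c * c `^ (b - 1)) = 1.
    by rewrite mulr_powRB1 ?(ltW c0)// powRN mulVf// gt_eqF// powR_gt0.
  rewrite [RHS](_ : _ = c `^ (- b) * (c * c `^ (b - 1)) *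
    (expR (- (c * t ^+ 2)) * (t `^ (2 * (b - 1)) * t))); last by field.
  by rewrite cb mul1r.
have k0 : 0 <= 2^-1 * c `^ (- b) by rewrite mulr_ge0 ?powR_ge0.
apply: ge0_integral_exhaust.
- apply: measurable_funM; last first.
    by apply: measurable_funTS; exact: measurable_powR.
  apply: measurable_funTS; apply: continuous_measurable_fun => x.
  apply: continuous_comp; last exact: continuous_expR.
  apply: continuousN; apply: continuousM; first exact: cst_continuous.
  exact: exprn_continuous.
- by move=> x x0; rewrite mulr_ge0 ?powR_ge0 ?expR_ge0.
(* On [x, y] the substitution is exact and gives the integral of [G] over [F x, F y], which is
   enlarged to the whole half-line. *)
move=> x y x0 xy.
have y0 : 0 < y by exact: lt_trans xy.
have incr : {in `[x, y] &, {homo F : u v / u < v}}.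
  move=> u v; rewrite !in_itv/= => /andP[xu _] /andP[xv _] uv.
  by rewrite /F ltr_pM2l// ltr_sqr ?nnegrE//; lra.
have cF' : continuous F^`()%classic.
  by rewrite F'E => t; exact: mulrl_continuous.
have cF : continuous F.
  by move=> t; apply/differentiable_continuous/derivable1_diffP; have [] := dF t.
have Fx0 : 0 < F x by rewrite /F mulr_gt0// exprn_gt0.
have sub : (\int[mu]_(t in `[F x, F y]) (G t)%:E =
    \int[mu]_(t in `[x, y]) (((G \o F) * F^`()%classic) t)%:E)%E.
  apply: integration_by_substitution_increasing => //; first exact: ltW.
  - by apply/cvg_ex; eexists; apply: cvg_at_right_filter; exact: cF'.
  - by apply/cvg_ex; eexists; apply: cvg_at_left_filter; exact: cF'.
  - split.
    + by move=> t _; have [] := dF t.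
    + by apply: cvg_at_right_filter; exact: cF.
    + by apply: cvg_at_left_filter; exact: cF.
  - apply: continuous_in_subspaceT => t; rewrite inE/= in_itv/= => /andP[Ft _].
    by apply: cG; exact: lt_le_trans Ft.
have cGF : measurable_fun (`[x, y]%classic : set R) (fun t => ((G \o F) * F^`()%classic) t).
  apply: measurable_funTS; apply: measurable_funM.
    by apply: measurableT_comp => //; exact: continuous_measurable_fun.
  exact: continuous_measurable_fun.
rewrite (_ : (\int[mu]_(t in `[x, y]) _ = (2^-1 * c `^ (- b))%:E *
    \int[mu]_(t in `[x, y]) (((G \o F) * F^`()%classic) t)%:E)%E); last first.
  rewrite -ge0_integralZl_EFin//; first last.
  - by apply/measurable_EFinP.
  - move=> t; rewrite /= in_itv/= => /andP[xt _].
    by rewrite lee_fin F'E mulr_ge0//= mulr_ge0; lra.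
  apply: eq_integral => t; rewrite inE/= in_itv/= => /andP[xt _].
  by rewrite intE ?(lt_le_trans x0 xt)// -EFinM F'E.
rewrite lee_wpmul2l ?lee_fin// -sub.
rewrite /GammaE.
have -> : (\int[mu]_(t in `]0%R, +oo[) (t `^ (b - 1) * expR (- t))%:E)%E =
          (\int[mu]_(t in D) (G t)%:E)%E by [].
apply: ge0_subset_integral => //.
- by apply/measurable_EFinP; exact: measurable_funTS.
- by move=> t _; rewrite lee_fin.
- move=> t; rewrite /= !in_itv/= => /andP[Ft _].
  by rewrite (lt_le_trans Fx0 Ft).
Qed.

End gaussian.

(** * Lorentz norms *)

Section lorentz.
Context {R : realType}.
Local Notation mu := (@lebesgue_measure R).
Local Notation pi := (@pi R).
Local Notation D := (`]0%R, +oo[%classic : set R).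
Implicit Types (q s t x y al : R).

(** As [sincpi] is [sinc] dilated by pi, its distribution function is that of [sinc] divided by pi,
    so the threshold t becomes pi t. *)
Lemma rearr_sincpi t : rearr (@sincpi R) t = rearr (@sinc R) (pi * t).
Proof.
have p0 := pi_gt0 R.
rewrite /rearr; congr inf; apply/seteqP.
have dE y : distrib (@sinc R) y = (pi%:E * distrib (@sincpi R) y)%E.
  rewrite /distrib (lebesgue_measure_mul p0); last exact: measurable_superlevel_sinc.
  congr (_ * mu _)%E; apply/seteqP; split => x /=; rewrite pmulr_rgt0//.
by split => y /= [y0 hy]; split => //; move: hy; rewrite dE EFinM lee_pmul2l.
Qed.

Lemma gauss_powR q t : gauss t `^ q = expR (- (q / (2 * pi) * t ^+ 2)).
Proof.
have : pi != 0 by rewrite gt_eqF// pi_gt0.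
by move=> pn; rewrite /gauss -expRM; congr expR; move: pi pn => c cn; field.
Qed.

Lemma rearr_sinc_gauss_le q al : 2 <= q -> 0 < al -> al <= 1 ->
  (\int[mu]_(t in D) (rearr sinc t `^ q * t `^ (al - 1))%:E <=
   \int[mu]_(t in D) (gauss t `^ q * t `^ (al - 1))%:E)%E.
Proof.
move=> q2 al0 al1; apply: rearr_sinc_lorentz_le => //.
  by rewrite integral_gauss_sqr; exact: integral_sinc_sqr_le.
by rewrite integral_gauss_sqr ltry.
Qed.

(** The factor does not depend on [h], so the inequality for [sincpi] follows from the one for
    [sinc] by dilating both sides. *)
Lemma integral_dilate q al (h : R -> R) : measurable_fun D h ->
  (\int[mu]_(t in D) (h (pi * t) `^ q * t `^ (al - 1))%:E =
   (pi^-1 * pi `^ (1 - al))%:E * \int[mu]_(t in D) (h t `^ q * t `^ (al - 1))%:E)%E.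
Proof.
move=> mh; have p0 := pi_gt0 R.
have mD : measurable D by exact: measurable_itv.
have mpow (f : R -> R) : measurable_fun D f -> measurable_fun D (fun t => (h t `^ q * f t)%:E).
  move=> mf; apply/measurable_EFinP; apply: measurable_funM => //.
  exact: (measurableT_comp (measurable_powR q)).
have mw : measurable_fun D (fun t => t `^ (al - 1)).
  by apply: measurable_funTS; exact: measurable_powR.
rewrite EFinM -muleA -ge0_integralZl_EFin//; first last.
- exact: powR_ge0.
- exact: mpow.
- by move=> t _; rewrite lee_fin mulr_ge0 ?powR_ge0.
have kE t : 0 < t -> pi `^ (1 - al) * t `^ (al - 1) = (pi^-1 * t) `^ (al - 1).
  move=> t0; rewrite powRM ?invr_ge0 ?(ltW t0) ?(ltW p0)//; congr (_ * _).
  by rewrite -(powR_inv1 (ltW p0)) -powRrM; congr (_ `^ _); ring.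
rewrite [in RHS](@ge0_integral_mul R pi)//; first last.
- by move=> t t0; rewrite -EFinM lee_fin !mulr_ge0 ?powR_ge0.
- by apply: measurable_funeM; exact: mpow.
rewrite muleA -EFinM mulVf ?gt_eqF// mul1e.
apply: eq_integral => t; rewrite inE/= in_itv/= andbT => t0.
rewrite -EFinM; congr (_%:E).
by rewrite mulrCA kE ?mulr_gt0// mulKf// gt_eqF.
Qed.

End lorentz.

Theorem mainTheorem9 (R : realType) :
  (forall p q : R, 2 <= q -> q <= p ->
    (\int[@lebesgue_measure R]_(t in `]0%R, +oo[%classic)
        ((rearr (@sincpi R) t) `^ q * t `^ (q / p - 1))%:E
     <= \int[@lebesgue_measure R]_(t in `]0%R, +oo[%classic)
        (expR (- (pi * q * t ^+ 2 / 2)) * t `^ (q / p - 1))%:E)%E)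
  /\
  (forall q alpha : R, 2 <= q -> 0 < alpha -> alpha <= 1 ->
    (\int[@lebesgue_measure R]_(t in `]0%R, +oo[%classic)
        ((rearr (@sinc R) t) `^ q * t `^ (alpha - 1))%:E
     <= (2^-1 * q `^ (- (alpha / 2)) * (2 * pi) `^ (alpha / 2))%:E
        * GammaE (alpha / 2))%E).
Proof.
have p0 := pi_gt0 R.
split=> [p q q2 qp|q al q2 al0 al1].
- have q0 : 0 < q by lra.
  have pp : 0 < p by lra.
  have al0 : 0 < q / p by rewrite divr_gt0.
  have al1 : q / p <= 1 by rewrite ler_pdivrMr// mul1r.
  under eq_integral do rewrite rearr_sincpi.
  rewrite (integral_dilate _ _ (measurable_rearr distrib_sinc_finite)).
  have -> : (\int[@lebesgue_measure R]_(t in `]0%R, +oo[%classic)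
        (expR (- (pi * q * t ^+ 2 / 2)) * t `^ (q / p - 1))%:E =
      \int[@lebesgue_measure R]_(t in `]0%R, +oo[%classic)
        (gauss (pi * t) `^ q * t `^ (q / p - 1))%:E)%E.
    apply: eq_integral => t _; congr (_ * _)%:E.
    rewrite gauss_powR; congr expR.
    have : pi != 0 :> R by rewrite gt_eqF.
    by move: (pi : R) => c cn; field.
  rewrite integral_dilate; last exact: measurable_gauss.
  apply: lee_wpmul2l; last exact: rearr_sinc_gauss_le.
  by rewrite lee_fin mulr_ge0 ?powR_ge0// invr_ge0 ltW.
- apply: (le_trans (rearr_sinc_gauss_le q2 al0 al1)).
  (* The Gamma bound is used with c = q / (2 pi) and b = al / 2, where c^(- b) = q^(- al / 2) (2
     pi)^(al / 2). *)
  have c0 : 0 < q / (2 * pi) by rewrite divr_gt0//; lra.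
  have b0 : 0 < al / 2 by lra.
  have := integral_gauss_powR_le c0 b0.
  rewrite (_ : 2 * (al / 2) = al); last by field.
  under eq_integral do rewrite -gauss_powR.
  move=> /le_trans; apply.
  rewrite powRM ?invr_ge0 ?mulr_ge0 ?(ltW p0)//; last by lra.
  rewrite -(@powR_inv1 _ (2 * pi)) ?mulr_ge0 ?(ltW p0)// -powRrM.
  by rewrite mulN1r opprK mulrA.
Qed.
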